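(* For each $\varepsilon\in(0,1)$ and each integer $n\ge 1$, let $\lambda_{\varepsilon,n}$ be the $n$th eigenvalue of the operator $L_\varepsilon$, where $L_\varepsilon$ is the closure, in $L^2((0,1),2w_\varepsilon(x)\,\mathrm{d}x)$, of the operator $$f\mapsto -\frac{\varepsilon}{2}\,w_\varepsilon(x)^{-1}(p_\varepsilon f')'(x)$$ with domain $\{f\in C^\infty([0,1]) : f(0)=0\}$. Then for every integer $n\ge 1$, $$\lambda_{\varepsilon,n}\to n\quad\text{as }\varepsilon\to 0^+.$$
   Context: For $0<\varepsilon<1$ and $x\in(0,1)$, $$w_\varepsilon(x)=x^{-1}(1-x)^{1/\varepsilon}(1+x)^{-1/\varepsilon},\qquad p_\varepsilon(x)=(1-x)^{1+1/\varepsilon}(1+x)^{1-1/\varepsilon}.$$ $C^\infty([0,1])$ denotes the complex-valued smooth functions on $[0,1]$. It is known from earlier work that $L_\varepsilon$ is self-adjoint with compact resolvent, and that its spectrum consists of infinitely many positive eigenvalues, each of multiplicity one; they are listed in increasing order $\lambda_{\varepsilon,1}<\lambda_{\varepsilon,2}<\cdots$. *)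

(* Defs.v *)
From HB Require Import structures.
From mathcomp Require Import all_boot all_order all_algebra.
From mathcomp Require Import all_classical all_reals all_analysis.
From mathcomp Require Import complex.

Set Implicit Arguments.
Unset Strict Implicit.
Unset Printing Implicit Defensive.

Import Order.TTheory GRing.Theory Num.Theory.
Import numFieldNormedType.Exports.
Import Normc.

Local Open Scope classical_set_scope.
Local Open Scope ring_scope.
Local Open Scope complex_scope.

(* Functions on (0, 1) or [0, 1] are represented by functions on all of R;
   no definition below depends on their values outside [0, 1]. *)

Section operator.
Context {R : realType}.
Implicit Types (eps x : R) (f g : R -> R[i]) (h : R -> R) (z : R[i]).

Definition weight eps x : R :=
  x^-1 * (1 - x) `^ (eps^-1) * (1 + x) `^ (- eps^-1).

Definition pcoef eps x : R :=
  (1 - x) `^ (1 + eps^-1) * (1 + x) `^ (1 - eps^-1).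

(* h is C^oo on the closed interval [0, 1]: D k is the continuous extension
   to [0, 1] of the k-th derivative of h on (0, 1). *)
Definition smooth01 h : Prop := exists D : nat -> R -> R,
  [/\ forall x, x \in `[0, 1] -> D 0%N x = h x,
      forall k, {within `[0, 1], continuous (D k)}
    & forall k x, x \in `]0, 1[ -> is_derive x 1 (D k) (D k.+1 x)].

(* R[i] carries no normed R-module structure, hence smoothness, derivatives
   and measurability of complex-valued functions are taken componentwise. *)
Definition csmooth01 f : Prop :=
  smooth01 (fun x => complex.Re (f x)) /\ smooth01 (fun x => complex.Im (f x)).

Definition cderive f x : R[i] :=
  derive1 (fun y => complex.Re (f y)) x +i* derive1 (fun y => complex.Im (f y)) x.

Definition L0_dom f : Prop := csmooth01 f /\ f 0 = 0.

Definition L0 eps f x : R[i] :=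
  - (eps / 2)%:C * ((weight eps x)^-1)%:C *
    cderive (fun y => (pcoef eps y)%:C * cderive f y) x.

(* The norm of L^2((0, 1), 2 w_eps(x) dx), with value +oo if f is not
   square integrable. *)
Definition L2norm eps f : \bar R :=
  ((\int[lebesgue_measure]_(x in `](0 : R)%R, 1%R[)
      (normc (f x) ^+ 2 * (2 * weight eps x))%:E) `^ 2^-1)%E.

Definition inL2 eps f : Prop :=
  [/\ measurable_fun `](0 : R), 1[ (fun x => complex.Re (f x)),
      measurable_fun `](0 : R), 1[ (fun x => complex.Im (f x))
    & (L2norm eps f < +oo)%E].

(* The graph of the closure L_eps of (L0 eps, L0_dom): [Lgraph eps f g] reads
   "f is in the domain of L_eps and L_eps f = g". Elements of L^2 are given by
   representatives; the relation is invariant under a.e. equality. *)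
Definition Lgraph eps f g : Prop :=
  [/\ inL2 eps f, inL2 eps g &
    exists u : nat -> R -> R[i],
      [/\ forall k, L0_dom (u k),
          L2norm eps (fun x => u k x - f x) @[k --> \oo] --> 0%E
        & L2norm eps (fun x => L0 eps (u k) x - g x) @[k --> \oo] --> 0%E]].

Definition L_eigenvalue eps z : Prop :=
  exists2 f, Lgraph eps f (fun x => z * f x) & L2norm eps f != 0%E.

(* l 1 < l 2 < ... is the list of all eigenvalues of L_eps; l 0 is unused. *)
Definition lists_eigenvalues eps (l : nat -> R) : Prop :=
  (forall m n, (1 <= m)%N -> (m < n)%N -> l m < l n) /\
  (forall z, L_eigenvalue eps z <-> exists2 n, (1 <= n)%N & z = (l n)%:C).

End operator.

(* Main.v *)
Require Import Defs.
From mathcomp Require Import all_boot all_order all_algebra.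
From mathcomp Require Import all_classical all_reals all_analysis.
From mathcomp Require Import complex.
From mathcomp Require Import measurable_realfun ring lra zify.
Import Order.TTheory GRing.Theory Num.Theory.
Import numFieldNormedType.Exports Normc.
Local Open Scope classical_set_scope.
Local Open Scope ring_scope.

Set Implicit Arguments.
Unset Strict Implicit.
Unset Printing Implicit Defensive.

(** On monomials [L x^j = j x^j + (eps/2) j ((j+1) x^(j+1) - (j-1) x^(j-1))], so
    for [f = sum_k (b_k / k) x^k] the equation [L f = l f] becomes
      [b_(k+2) = b_k + a_(k+1) b_(k+1)],  [a_k = (2/eps) (k - l) / k^2],  [b_0 = 0].
    Up to a factor, the moments [(-1)^k k <f, x^k>] of an eigenfunction [f] solve the
    same recurrence, because [L] is symmetric; they tend to [0] since [k] times
    the norm of [x^k] does.  They do not all vanish, because polynomials are dense.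
    Conversely, if [b] is bounded and [b_k / k] is summable then the polynomial
    truncations of [f] converge to an eigenfunction in the graph norm.  So for small
    [eps] the eigenvalues are the [l] for which the solution of the recurrence decays.

    For [k > l] we have [a_k > 0], so the solution either eventually keeps a constant
    sign, and then does not decay, or alternates in sign, and then decays.  As
    [eps -> 0] the [|a_k|] with [k] away from [l] blow up: if [l] is not near a
    positive integer the solution grows and ends with a constant sign, and this sign
    changes as [l] crosses a neighbourhood of [n], so that some [l] near [n] is an
    eigenvalue.  Two eigenvalues [l], [l'] near [n] would give solutions [b], [b']
    with [sum_k (-1)^k b_k b'_k / k^2 = 0], which is impossible as the summand
    [k = n] dominates. *)

(** * The recurrence *)

Section recurrence.
Context {R : realType}.
Implicit Types (a u v : nat -> R) (k n m K N : nat).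

Definition recurrence a u := forall k, u k.+2 = u k + a k.+1 * u k.+1.

Lemma recurrenceN a u : recurrence a u -> recurrence a (fun k => - u k).
Proof. by move=> h k; rewrite h; ring. Qed.

Lemma recurrence_pos a u K : recurrence a u -> (forall k, (K < k)%N -> 0 <= a k) ->
  0 < u K -> 0 < u K.+1 -> forall k, (K <= k)%N -> 0 < u k /\ 0 < u k.+1.
Proof.
move=> hu ha u0 u1 k /subnK <-; elim: (k - K)%N => [//|j [p0 p1]].
rewrite addSn; split=> //; rewrite hu ltr_wpDr// mulr_ge0 ?(ltW p1)//.
by apply: ha; lia.
Qed.

Lemma recurrence_pos_ncvg a u K : recurrence a u -> (forall k, (K < k)%N -> 0 <= a k) ->
  0 < u K -> 0 < u K.+1 -> ~ u @ \oo --> 0.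
Proof.
move=> hu ha u0 u1 /cvgrPdist_lt /(_ _ u0) [N _ hN].
have hp := recurrence_pos hu ha u0 u1.
have hmono j : u K <= u (K + j.*2)%N.
  elim: j => [|j IH]; first by rewrite addn0.
  rewrite doubleS !addnS hu (le_trans IH)// lerDl mulr_ge0//.
    by apply: ha; lia.
  by have [_ /ltW] := hp (K + j.*2)%N (leq_addr _ _).
have := hN (K + N.*2)%N; rewrite /= sub0r normrN => /(_ _)/wrap[]; first by lia.
by rewrite ltNge (le_trans (hmono N)) ?ler_norm.
Qed.

Lemma recurrence_same_sign_ncvg a u K : recurrence a u ->
  (forall k, (K < k)%N -> 0 <= a k) -> 0 < u K * u K.+1 -> ~ u @ \oo --> 0.
Proof.
move=> hu ha; case: (ltrgt0P (u K)) => [u0|u0|->]; last by rewrite mul0r ltxx.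
  by rewrite pmulr_rgt0// => u1; apply: recurrence_pos_ncvg hu ha u0 u1.
rewrite nmulr_rgt0// => u1 /cvgN; rewrite oppr0.
by apply: (recurrence_pos_ncvg (recurrenceN hu) ha); rewrite oppr_gt0.
Qed.

(** The triangle inequality gives [|u k.+2| >= A |u k.+1| - |u k|], and [A - 1 >= 1] gives
    [|u k| <= |u k.+1|] by induction, whatever the signs of the [a k]. *)
Lemma recurrence_growth a u A m : recurrence a u -> u 0%N = 0 -> u 1%N = 1 -> 2 <= A ->
  (forall k, (0 < k <= m)%N -> A <= `|a k|) ->
  forall k, (k <= m)%N -> (A - 1) * `|u k| <= `|u k.+1| /\ u k.+1 != 0.
Proof.
move=> hu u0 u1 hA ha; elim=> [|k IH] km.
  by rewrite u0 u1 normr0 mulr0 normr1 ler01 oner_eq0.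
have [h1 h2] := IH (ltnW km).
have hk : `|u k| <= `|u k.+1|.
  by apply: le_trans h1; rewrite ler_peMl//; lra.
have : `|a k.+1| * `|u k.+1| - `|u k| <= `|u k.+2|.
  by rewrite hu -normrM [X in _ <= `|X|]addrC lerB_normD.
have hA' : A <= `|a k.+1| by apply: ha; lia.
have hp : 0 < `|u k.+1| by rewrite normr_gt0.
have hq : A * `|u k.+1| <= `|a k.+1| * `|u k.+1| by rewrite ler_wpM2r.
move=> h3; split; first by lra.
rewrite -normr_gt0; apply: lt_le_trans h3; nra.
Qed.

(** Growth yields [|u m| <= |u m.+1|], so [a m.+1 >= 2] gives [u m.+2] the sign of [u m.+1]; from
    there on the sign is locked. *)
Lemma recurrence_large_ncvg a u m : recurrence a u -> u 0%N = 0 -> u 1%N = 1 ->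
  (forall k, (0 < k <= m.+1)%N -> 2 <= `|a k|) ->
  (forall k, (m < k)%N -> 0 <= a k) -> ~ u @ \oo --> 0.
Proof.
move=> hu u0 u1 ha ha0.
have g k := recurrence_growth hu u0 u1 (lexx 2) ha (k := k).
have [g1 gm] := g m (leqnSn m).
apply: (recurrence_same_sign_ncvg (K := m.+1) hu).
  by move=> k mk; apply: ha0; lia.
have := ha m.+1; rewrite ger0_norm ?ha0// => /(_ _)/wrap[]; first by lia.
move=> h2; rewrite hu mulrDr mulrCA -expr2.
have h3 : 0 < u m.+1 ^+ 2 by rewrite exprn_even_gt0.
have h4 : 2 * u m.+1 ^+ 2 <= a m.+1 * u m.+1 ^+ 2 by rewrite ler_pM2r.
have h5 : - (u m.+1 ^+ 2) <= u m.+1 * u m.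
  rewrite lerNl (le_trans (ler_norm _))// normrN normrM -[leRHS]real_normK ?num_real//.
  by rewrite expr2; apply: ler_wpM2l => //; lra.
lra.
Qed.

Definition alternates_from n u := forall k, (n <= k)%N -> u k * u k.+1 <= 0.

Lemma cvg0_alternating a u n : recurrence a u -> (forall k, (n < k)%N -> 0 <= a k) ->
  u @ \oo --> 0 -> alternates_from n u.
Proof.
move=> hu ha u0 k nk; rewrite leNgt; apply/negP => h.
by apply: (recurrence_same_sign_ncvg hu _ h) => // j kj; apply: ha; lia.
Qed.

(** Under alternation, [u k = u k.+2 - a k.+1 * u k.+1] adds two terms of the same sign. *)
Lemma alternating_norm a u n k : recurrence a u -> alternates_from n u ->
  (forall k, (n < k)%N -> 0 <= a k) ->
  (n <= k)%N -> `|u k.+2| + a k.+1 * `|u k.+1| = `|u k|.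
Proof.
move=> hu hal ha nk; have := hal k nk; have := hal k.+1; rewrite leqW// => /(_ isT).
rewrite hu; set x := u k; set y := u k.+1; have /ha : (n < k.+1)%N by lia.
set c := a _ => c0.
case: (ltrgt0P y) => [y0|y0|->]; last by rewrite !mulr0 !addr0.
  rewrite pmulr_rle0// pmulr_lle0// => h x0.
  by rewrite ler0_norm// (ler0_norm x0); ring.
rewrite nmulr_rle0// nmulr_lle0// => h x0.
by rewrite ger0_norm// (ger0_norm x0); ring.
Qed.

(** [alternating_norm] bounds [u n.+1] and [u n.+2]; it also makes [|u k|] nonincreasing along each
    parity class, which carries both bounds on. *)
Lemma alternating_tail_le a u n C : recurrence a u -> alternates_from n u ->
  (forall k, (n < k)%N -> 0 <= a k) -> 0 < C -> C <= a n.+1 -> C <= a n.+2 ->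
  1 <= C ->
  forall k, (n < k)%N -> `|u k| <= C^-1 * `|u n|.
Proof.
move=> hu hal ha C0 a1 a2 C1.
have hn k := alternating_norm hu hal ha (k := k).
have h1 : `|u n.+1| <= C^-1 * `|u n|.
  rewrite ler_pdivlMl// -(hn n)// -[leLHS]add0r lerD//.
  by rewrite ler_wpM2r.
have h2 : `|u n.+2| <= C^-1 * `|u n|.
  apply: le_trans h1; rewrite -(hn n.+1) ?leqnSn// -[leLHS]add0r lerD//.
  by rewrite ler_peMl// (le_trans C1).
have h j : `|u (n.+1 + j)%N| <= C^-1 * `|u n| /\ `|u (n.+1 + j).+1| <= C^-1 * `|u n|.
  elim: j => [|j [p q]]; first by rewrite addn0.
  rewrite addnS; split=> //; apply: le_trans p; rewrite -(hn (n.+1 + j)%N).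
    by rewrite lerDl mulr_ge0// ha//; lia.
  by lia.
by move=> k nk; have [] := h (k - n.+1)%N; rewrite subnKC.
Qed.

(** [|u k|] is nondecreasing up to [m], and the last step alone gains the factor [A - 1]. *)
Lemma growth_head_le a u A m : recurrence a u -> u 0%N = 0 -> u 1%N = 1 -> 2 <= A ->
  (forall k, (0 < k < m)%N -> A <= `|a k|) ->
  forall k, (k < m)%N -> `|u k| <= (A - 1)^-1 * `|u m|.
Proof.
move=> hu u0 u1 hA ha; case: m ha => // m ha.
have g k := recurrence_growth (m := m) hu u0 u1 hA ha (k := k).
move=> k; rewrite ltnS => km; have A1 : 0 < A - 1 by lra.
rewrite ler_pdivlMl//.
have [h _] := g m (leqnn m); apply: le_trans h; rewrite ler_wpM2l//; first by lra.
rewrite -(subnKC km); have : (k + (m - k) <= m)%N by lia.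
elim: (m - k)%N => [|j IH]; first by rewrite addn0.
rewrite addnS => h; apply: le_trans (IH (ltnW h)) _.
by have [h1 _] := g _ (ltnW h); apply: le_trans h1; rewrite ler_peMl//; lra.
Qed.

Lemma sum_inv_sqr_le2 N : \sum_(j < N) (j%:R ^- 2 : R) <= 2.
Proof.
(* The sharper bound [2 - 1 / (M + 1)] makes the induction telescope; the term [j = 0] is [0], as
   the inverse of [0] is [0]. *)
have h M : \sum_(j < M.+2) (j%:R ^- 2 : R) <= 2 - M.+1%:R^-1.
  elim: M => [|M IH]; first by rewrite !big_ord_recr big_ord0 /= expr0n /= !invr1 invr0; lra.
  rewrite big_ord_recr /=; apply: le_trans (lerD IH (lexx _)) _.
  have p1 : 0 < M.+1%:R :> R by rewrite ltr0n.
  rewrite [M.+2%:R]mulrS; set x := M.+1%:R in p1 *.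
  have p2 : 0 < 1 + x by lra.
  rewrite -subr_ge0.
  rewrite (_ : _ - _ = x^-1 * (1 + x)^-2); last by field; rewrite !gt_eqF.
  by rewrite mulr_ge0 ?invr_ge0 ?exprn_ge0// ltW.
case: N => [|[|M]]; rewrite ?big_ord0 ?ler0n//.
  by rewrite big_ord_recr big_ord0 /= expr0n /= invr0 addr0 ler0n.
by apply: le_trans (h M) _; rewrite gerBl invr_ge0.
Qed.

(** The threshold [2 n + 1] yields a ratio [A - 1 = 2 n] by growth before [n], and [2 n + 1] by
    alternation after it. *)
Lemma recurrence_dominant a u n : recurrence a u -> u 0%N = 0 -> u 1%N = 1 ->
  (0 < n)%N -> (forall k, (n < k)%N -> 0 <= a k) ->
  (forall k, (0 < k <= n.+2)%N -> k != n -> 2 * n%:R + 1 <= `|a k|) ->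
  u @ \oo --> 0 ->
  u n != 0 /\ forall k, k != n -> `|u k| <= (2 * n%:R)^-1 * `|u n|.
Proof.
move=> hu u0 u1 n0 ha hA uc.
have n1 : 1 <= n%:R :> R by rewrite ler1n.
have hA1 k : (0 < k < n)%N -> 2 * n%:R + 1 <= `|a k| by move=> ?; apply: hA; lia.
have h2 : 2 <= 2 * n%:R + 1 :> R by lra.
split.
  have hA1' k : (0 < k <= n.-1)%N -> 2 * n%:R + 1 <= `|a k| by move=> ?; apply: hA; lia.
  by have [_] := recurrence_growth hu u0 u1 h2 hA1' (leqnn _); rewrite prednK.
move=> k; case: ltngtP => // kn _.
  by have := growth_head_le hu u0 u1 h2 hA1 kn; rewrite addrK.
have h1 j : (n < j <= n.+2)%N -> 2 * n%:R + 1 <= a j.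
  by move=> ?; rewrite -[leRHS]ger0_norm; [apply: hA|apply: ha]; lia.
have := @alternating_tail_le a u n (2 * n%:R + 1) hu (cvg0_alternating hu ha uc) ha.
move=> /(_ _ _ _ _ _ kn)/wrap[]; rewrite ?h1 ?ltnSn ?leqnn ?leqnSn//; try lra.
move=> /le_trans; apply; rewrite ler_wpM2r// lef_pV2 ?posrE; lra.
Qed.

(* Pairing [u] with [(-1)^j v_j], which solves the recurrence with [- a'],
   telescopes to a boundary term; the [j = n] summand dominates all others. *)
Lemma recurrence_cvg0_unique a a' u v n c :
  recurrence a u -> recurrence a' v ->
  u 0%N = 0 -> u 1%N = 1 -> v 0%N = 0 -> v 1%N = 1 -> (0 < n)%N ->
  (forall k, a k - a' k = c * k%:R ^- 2) ->
  (forall k, (n < k)%N -> 0 <= a k) -> (forall k, (n < k)%N -> 0 <= a' k) ->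
  (forall k, (0 < k <= n.+2)%N -> k != n -> 2 * n%:R + 1 <= `|a k|) ->
  (forall k, (0 < k <= n.+2)%N -> k != n -> 2 * n%:R + 1 <= `|a' k|) ->
  u @ \oo --> 0 -> v @ \oo --> 0 -> c = 0.
Proof.
move=> hu hv u0 u1 v0 v1 n0 hc ha ha' hA hA' uc vc.
have [un ud] := recurrence_dominant hu u0 u1 n0 ha hA uc.
have [vn vd] := recurrence_dominant hv v0 v1 n0 ha' hA' vc.
pose t j : R := j%:R ^- 2 * ((-1) ^+ j * u j * v j).
(* The Casoratian of [u] and [v] changes sign at each step, up to [(a - a') u v]; the factor
   [(-1) ^+ N] compensates. *)
pose W N : R := (-1) ^+ N * (u N.+1 * v N - u N * v N.+1).
have hW N : c * \sum_(j < N.+1) t j = W N.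
  elim: N => [|N IH].
    by rewrite big_ord_recr big_ord0 /t /W /= u0 v0; ring.
  rewrite big_ord_recr /= mulrDr IH /t /W hu hv [(-1) ^+ N.+1]exprS.
  rewrite (_ : c * _ = (c * N.+1%:R ^- 2) * (-1 * (-1) ^+ N * u N.+1 * v N.+1)); last by ring.
  by rewrite -hc; ring.
(* [B] bounds [|u j * v j|] for [j != n]. The summand at [n] has modulus [4 B], and the others add
   up to at most [2 B] because the [j^-2] sum to at most [2]. *)
pose B : R := (2 * n%:R)^-2 * `|u n * v n|.
have n1 : 1 <= n%:R :> R by rewrite ler1n.
have B0 : 0 < B by rewrite mulr_gt0 ?normr_gt0 ?mulf_neq0// invr_gt0 exprn_gt0//; lra.
have hB N : (n <= N)%N -> 2 * B <= `|\sum_(j < N.+1) t j|.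
  move=> nN; have nN' : (n < N.+1)%N by [].
  rewrite (bigD1 (Ordinal nN'))//=.
  have ht : `|t n| = 4 * B.
    rewrite /t /B normrM -mulrA normrM normrX normrN1 expr1n mul1r.
    rewrite ger0_norm ?invr_ge0 ?exprn_ge0//; field; lra.
  have hr : `|\sum_(j < N.+1 | j != Ordinal nN') t j| <= 2 * B.
    apply: le_trans (ler_norm_sum _ _ _) _.
    apply: le_trans (_ : \sum_(j < N.+1) j%:R ^- 2 * B <= _); last first.
      by rewrite -mulr_suml ler_wpM2r ?sum_inv_sqr_le2// ltW.
    rewrite big_mkcond /=; apply: ler_sum => j _; case: ifPn => hj; last first.
      by rewrite mulr_ge0 ?invr_ge0 ?exprn_ge0// ltW.
    have jn : (j != n :> nat) by apply: contraNneq hj => hj; apply/eqP/val_inj.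
    rewrite /t /B normrM -mulrA normrM normrX normrN1 expr1n mul1r.
    rewrite ger0_norm ?invr_ge0 ?exprn_ge0// ler_wpM2l ?invr_ge0 ?exprn_ge0//.
    by rewrite !normrM -exprVn expr2 mulrACA ler_pM ?ud ?vd.
  have := lerB_normD (t n) (\sum_(j < N.+1 | j != Ordinal nN') t j).
  by move: hr; rewrite ht => *; lra.
have Wc : W @ \oo --> 0.
  have u1c : u n.+1 @[n --> \oo] --> 0.
    by apply: (cvg_comp (fun k => k.+1) u) uc; exact: cvg_addnl 1.
  have v1c : v n.+1 @[n --> \oo] --> 0.
    by apply: (cvg_comp (fun k => k.+1) v) vc; exact: cvg_addnl 1.
  apply/cvgr0Pnorm_lt => e e0 /=.
  have : `|u n.+1 * v n - u n * v n.+1| @[n --> \oo] --> 0.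
    apply/norm_cvg0P; rewrite -(subr0 0) -{1}(mulr0 0) -[X in _ - X](mulr0 0).
    by apply: cvgB; apply: cvgM.
  move=> /cvgr0_norm_lt /(_ _ e0); apply: filterS => N.
  by rewrite /W normrM normrX normrN1 expr1n mul1r normr_id.
apply/eqP/negPn/negP => c0.
have c0' : 0 < `|c| by rewrite normr_gt0.
have p : 0 < `|c| * (2 * B) by rewrite mulr_gt0// mulr_gt0.
move/cvgr0_norm_lt : Wc => /(_ _ p) [N _ /(_ (n + N)%N)/(_ (leq_addl _ _)) /=].
by rewrite -hW normrM ltr_pM2l// ltNge hB// leq_addr.
Qed.
End recurrence.

(** * Decaying solutions for the coefficients of the eigenvalue equation *)

Section coefficients.
Context {R : realType}.
Implicit Types (a u v : nat -> R) (eps l d : R) (k n m K N : nat).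

Definition rcoef eps l k : R := 2 / eps * (k%:R - l) / k%:R ^+ 2.

Fixpoint rsol a k {struct k} : R :=
  match k with
  | 0 => 0
  | k1.+1 => match k1 with 0 => 1 | k2.+1 => rsol a k2 + a k1 * rsol a k1 end
  end.

Lemma rsol_recurrence a : recurrence a (rsol a).
Proof. by []. Qed.

Lemma recurrence_rsol a u : recurrence a u -> u 0%N = 0 ->
  forall k, u k = u 1%N * rsol a k.
Proof.
move=> hu u0 k; suff: u k = u 1%N * rsol a k /\ u k.+1 = u 1%N * rsol a k.+1 by case.
elim: k => [|k [h1 h2]]; first by rewrite u0 /= mulr0 mulr1.
by split=> //; rewrite hu h1 h2 rsol_recurrence; ring.
Qed.

Lemma rsol_continuous eps k : continuous (fun l => rsol (rcoef eps l) k).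
Proof.
suff: continuous (fun l => rsol (rcoef eps l) k) /\
  continuous (fun l => rsol (rcoef eps l) k.+1) by case.
elim: k => [|k [h1 h2]]; first by split=> x; exact: cvg_cst.
split=> // x; apply: cvgD; first exact: h1.
apply: cvgM; last exact: h2.
rewrite /rcoef; apply: cvgM; last exact: cvg_cst.
apply: cvgM; first exact: cvg_cst.
by apply: cvgB; [exact: cvg_cst|exact: cvg_id].
Qed.

Lemma rcoef_norm_ge eps l k d A : 0 < eps -> (0 < k)%N -> d <= `|k%:R - l| ->
  A * eps * k%:R ^+ 2 <= 2 * d -> A <= `|rcoef eps l k|.
Proof.
move=> e0 k0 hd hA; have k2 : 0 < k%:R ^+ 2 :> R by rewrite exprn_gt0 ?ltr0n.
rewrite /rcoef normrM normrM normfV (gtr0_norm k2) normrM normfV (gtr0_norm e0).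
rewrite ger0_norm// ler_pdivlMr// mulrAC ler_pdivlMr//; nra.
Qed.

Lemma rcoef_ge0 eps l k : 0 < eps -> l <= k%:R -> 0 <= rcoef eps l k.
Proof.
move=> e0 h; rewrite /rcoef !mulr_ge0 ?invr_ge0 ?exprn_ge0 ?subr_ge0//.
exact: ltW.
Qed.

Lemma rcoef_le0 eps l k : 0 < eps -> k%:R <= l -> rcoef eps l k <= 0.
Proof.
move=> e0 h; rewrite /rcoef mulr_le0_ge0 ?invr_ge0 ?exprn_ge0//.
by rewrite mulr_ge0_le0 ?subr_le0 ?divr_ge0// ltW.
Qed.

(* The proof of [recurrence_cvg0_unique] needs [|a_k| >= 2 n + 1]; this is the
   resulting smallness condition on [eps]. *)
Definition small_eps eps d n := (2 * n%:R + 1) * eps * n.+2%:R ^+ 2 <= 2 * d.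

Lemma small_rcoef_ge eps l k d n : 0 < eps -> small_eps eps d n ->
  (0 < k <= n.+2)%N -> d <= `|k%:R - l| -> 2 * n%:R + 1 <= `|rcoef eps l k|.
Proof.
move=> e0 hs /andP[k0 kn] hd; apply: (rcoef_norm_ge e0 k0 hd).
apply: le_trans hs; apply: ler_wpM2l; first by rewrite mulr_ge0 ?addr_ge0 ?mulr_ge0 ?ler0n// ltW.
by rewrite lerXn2r ?nnegrE ?ler0n// ler_nat.
Qed.

(** If [l] is at distance [d] from [1, ..., n], then [l < n + d] and [d <= 1/2] keep it as far from
    the larger integers, and [recurrence_large_ncvg] excludes decay. *)
Lemma rsol_cvg0_near_nat eps l d n : 0 < eps -> 0 < d <= 2^-1 -> (0 < n)%N ->
  small_eps eps d n -> rsol (rcoef eps l) @ \oo --> 0 -> l < n%:R + d ->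
  exists2 k, (0 < k <= n)%N & `|l - k%:R| < d.
Proof.
move=> e0 /andP[d0 d2] n0 hs hc hl; apply: contrapT => hk.
have hn k : (0 < k)%N -> d <= `|k%:R - l|.
  move=> k0; rewrite leNgt distrC; apply/negP => h.
  have [kn|nk] := leqP k n; first by apply: hk; exists k => //; rewrite k0.
  have : n%:R + 1 <= k%:R :> R by rewrite natr1 ler_nat.
  by move: h; rewrite ltr_norml => /andP[]; lra.
have n1 : 1 <= n%:R :> R by rewrite ler1n.
apply: (@recurrence_large_ncvg _ (rcoef eps l) _ n (rsol_recurrence _) _ _ _ _ hc) => //.
  move=> k hk'; apply: (@le_trans _ _ (2 * n%:R + 1)); first by lra.
  by apply: small_rcoef_ge hs _ (hn _ _) => //; lia.
move=> k nk; apply: rcoef_ge0 => //.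
have : n%:R + 1 <= k%:R :> R by rewrite natr1 ler_nat.
lra.
Qed.

Lemma small_le eps d k n : 0 < eps -> (k <= n)%N -> small_eps eps d n -> small_eps eps d k.
Proof.
move=> e0 kn; apply: le_trans.
have kn' : k%:R <= n%:R :> R by rewrite ler_nat.
apply: ler_pM; rewrite ?exprn_ge0 ?ler0n ?mulr_ge0 ?addr_ge0 ?mulr_ge0 ?ler0n ?(ltW e0)//.
- by rewrite ler_pM2r//; lra.
by rewrite lerXn2r ?nnegrE ?ler0n// ler_nat !ltnS.
Qed.

Lemma near_nat_dist l d n k : d <= 2^-1 -> `|l - n%:R| <= d -> k != n -> d <= `|k%:R - l|.
Proof.
move=> d2 hl kn; have : 1 <= `|k%:R - n%:R| :> R.
  case: (ltngtP k n) kn => // h _.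
    by rewrite distrC ger0_norm ?subr_ge0 ?ler_nat ?(ltnW h)// lerBrDr addrC natr1 ler_nat.
  by rewrite ger0_norm ?subr_ge0 ?ler_nat ?(ltnW h)// lerBrDr addrC natr1 ler_nat.
have := ler_distD l (k%:R : R) n%:R; lra.
Qed.

Lemma near_nat_rcoef_ge0 eps l d n k : 0 < eps -> d <= 2^-1 -> `|l - n%:R| <= d ->
  (n < k)%N -> 0 <= rcoef eps l k.
Proof.
move=> e0 d2; rewrite ler_norml => /andP[_ h] nk; apply: rcoef_ge0 => //.
have : n%:R + 1 <= k%:R :> R by rewrite natr1 ler_nat.
lra.
Qed.

(** The two coefficient sequences differ by [(2 / eps) (l' - l) / k^2], the form whose constant
    [recurrence_cvg0_unique] forces to be [0]. *)
Lemma rsol_cvg0_unique eps l l' d n : 0 < eps -> 0 < d <= 2^-1 -> (0 < n)%N ->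
  small_eps eps d n -> rsol (rcoef eps l) @ \oo --> 0 -> rsol (rcoef eps l') @ \oo --> 0 ->
  `|l - n%:R| <= d -> `|l' - n%:R| <= d -> l = l'.
Proof.
move=> e0 /andP[d0 d2] n0 hs hl hm ln mn.
have := @recurrence_cvg0_unique _ (rcoef eps l) (rcoef eps l') _ _ n (2 / eps * (l' - l))
  (rsol_recurrence _) (rsol_recurrence _) erefl erefl erefl erefl n0.
move=> /(_ _ _ _ _ _ hl hm)/wrap[].
- by move=> k; rewrite /rcoef -mulrBl -mulrBr; congr (_ * _ * _); ring.
- by move=> k; apply: near_nat_rcoef_ge0 ln.
- by move=> k; apply: near_nat_rcoef_ge0 mn.
- by move=> k kn /(near_nat_dist d2 ln); apply: small_rcoef_ge hs _.
- by move=> k kn /(near_nat_dist d2 mn); apply: small_rcoef_ge hs _.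
by move/eqP; rewrite mulf_eq0 gt_eqF ?divr_gt0//= subr_eq0 => /eqP.
Qed.

(* Eventually, the solution either keeps a constant sign or alternates; the first
   behaviour is open in [l], and its sign changes between [n - d] and [n + d]. *)
Lemma rsol_alternating_exists eps d n : 0 < eps -> 0 < d <= 2^-1 -> (0 < n)%N ->
  small_eps eps d n ->
  exists2 l, `|l - n%:R| <= d & alternates_from n (rsol (rcoef eps l)).
Proof.
move=> e0 /andP[d0 d2] n0 hs.
have n1 : 1 <= n%:R :> R by rewrite ler1n.
pose b l k := rsol (rcoef eps l) k.
pose s : R := (-1) ^+ n.-1.
(* For [l] within [d] of [n], two consecutive values of the sign of [t] past [n] fix the sign for
   ever. The condition involves only two values, continuous in [l], so [U t] is open. *)
pose U (t : R) := [set l | exists2 k, (n <= k)%N & 0 < t * b l k /\ 0 < t * b l k.+1].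
have Uo t : open (U t).
  rewrite (_ : U t = \bigcup_(k in [set k | (n <= k)%N])
      ([set l | 0 < t * b l k] `&` [set l | 0 < t * b l k.+1])); last first.
    by apply/seteqP; split=> l /= [k nk h]; exists k.
  apply: bigcup_open => k _.
  have bo j : open [set l | 0 < t * b l j].
    apply: (@open_comp _ _ (fun l => t * b l j) [set x | 0 < x]); last exact: open_gt.
    by move=> x _; apply: cvgM; [exact: cvg_cst|exact: rsol_continuous].
  by apply: openI.
have Rt t l : recurrence (rcoef eps l) (fun k => t * b l k).
  by move=> k; rewrite /b rsol_recurrence; ring.
have in_itv l : `[n%:R - d, n%:R + d]%classic l = (`|l - n%:R| <= d) :> Prop.
  by rewrite /= in_itv /= ler_distl.
have UU t l : `|l - n%:R| <= d -> U t l -> U (- t) l -> False.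
  move=> hl [k nk [p1 p2]] [j nj [q1 q2]].
  have hc (i m : nat) : (n <= i)%N -> (i < m)%N -> 0 <= rcoef eps l m.
    by move=> ni im; apply: near_nat_rcoef_ge0 hl _ => //; lia.
  have [r1 _] := recurrence_pos (Rt t l) (hc _ ^~ nk) p1 p2 (leq_maxl k j).
  have [r2 _] := recurrence_pos (Rt (- t) l) (hc _ ^~ nj) q1 q2 (leq_maxr k j).
  by move: r1 r2; rewrite mulNr; lra.
(* Coefficients at most [- 2] make the solution alternate without shrinking, so [b t j.+1] has sign
   [(-1) ^+ j]; a next coefficient of at least [2] repeats that sign. *)
have hU t j : (n <= j.+1)%N -> (forall k, (0 < k <= j)%N -> rcoef eps t k <= - 2) ->
    2 <= rcoef eps t j.+1 -> U ((-1) ^+ j) t.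
  move=> nj hj hj1.
  have [p q r] : [/\ 1 <= (-1) ^+ j * b t j.+1, 0 <= - ((-1) ^+ j * b t j)
      & - ((-1) ^+ j * b t j) <= (-1) ^+ j * b t j.+1].
    elim: j {nj hj1} hj => [|j IH] hj; first by rewrite /b /= expr0 !mul1r; split; lra.
    have [|p q r] := IH; first by move=> k ?; apply: hj; lia.
    have := hj j.+1; rewrite /= ltnSn => /(_ isT) hr.
    rewrite {1 4}/b rsol_recurrence exprS -/(b t j) -/(b t j.+1).
    by split; nra.
  exists j.+1 => //; split; first by lra.
  by rewrite {1}/b rsol_recurrence -/(b t j) -/(b t j.+1); nra.
have large l k : `|l - n%:R| <= d -> (0 < k <= n.+2)%N -> d <= `|k%:R - l| ->
    2 <= `|rcoef eps l k|.
  by move=> hl hk hd; apply: le_trans (small_rcoef_ge e0 hs hk hd); lra.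
have hlo : `|n%:R - d - n%:R| <= d by rewrite addrAC subrr sub0r normrN ger0_norm// ltW.
have hhi : `|n%:R + d - n%:R| <= d by rewrite addrAC subrr add0r ger0_norm// ltW.
have lt_nat (i j : nat) : (i < j)%N -> i%:R + 1 <= j%:R :> R by rewrite natr1 ler_nat.
(* At [n - d] the negative coefficients are those with [0 < k < n]. *)
have Ulo : U s (n%:R - d).
  apply: hU => [|k hk|]; rewrite ?prednK//.
    have kn : k != n by lia.
    have := large _ k hlo; rewrite [`|rcoef _ _ _|]ler0_norm; last first.
      by apply: rcoef_le0 => //; have := lt_nat k n; move=> /(_ _)/wrap[]; [lia|lra].
    by move=> /(_ _ (near_nat_dist d2 hlo kn))/wrap[]; [lia|lra].
  have := large _ n hlo; rewrite [`|rcoef _ _ _|]ger0_norm; last by apply: rcoef_ge0 => //; lra.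
  apply; first by lia.
  by rewrite opprB addrCA subrr addr0 ger0_norm// ltW.
(* At [n + d] the coefficient at [k = n] is negative too, which flips the sign. *)
have Uhi : U (- s) (n%:R + d).
  have -> : - s = (-1) ^+ n by rewrite /s -[in RHS](prednK n0) exprS mulN1r.
  apply: hU => // [k hk|].
    have hk2 : (0 < k <= n.+2)%N by lia.
    have := large _ k hhi hk2; rewrite [`|rcoef _ _ _|]ler0_norm; last first.
      apply: rcoef_le0 => //; have : k%:R <= n%:R :> R by rewrite ler_nat; lia.
      lra.
    have [->|kn] := eqVneq k n.
      by rewrite opprD addrA subrr sub0r normrN ger0_norm ?(ltW d0)// => /(_ (lexx _)); lra.
    by move=> /(_ (near_nat_dist d2 hhi kn)); lra.
  have hn : n.+1 != n by lia.
  have := large _ n.+1 hhi; rewrite [`|rcoef _ _ _|]ger0_norm; last first.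
    exact: near_nat_rcoef_ge0 hhi _.
  apply; first by lia.
  exact: near_nat_dist hhi hn.
(* Otherwise the disjoint open sets [U s] and [U (- s)], each containing an endpoint, would cover an
   interval. *)
have [l hl Ul] : exists2 l, `|l - n%:R| <= d & ~ (U s l \/ U (- s) l).
  apply: contrapT => hex.
  have cover l : `|l - n%:R| <= d -> U s l \/ U (- s) l.
    by move=> hl; apply: contrapT => h; apply: hex; exists l.
  have /seteqP[_ /(_ (n%:R + d))] :
      (`[n%:R - d, n%:R + d] `&` U s = `[n%:R - d, n%:R + d])%classic.
    apply: segment_connected; first by exists (n%:R - d); split => //; rewrite in_itv.
      by exists (U s).
    exists (~` U (- s)); first exact: open_closedC.
    apply/seteqP; split=> l [hl h]; split=> //; move: hl; rewrite in_itv => hl.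
      by move=> h'; apply: (UU s l).
    by have [] := cover l hl.
  by rewrite in_itv => /(_ hhi) [_ h]; apply: UU hhi h Uhi.
(* Equal signs at [k] and [k.+1] would put [l] into [U 1] or [U (- 1)]. *)
exists l => // k nk; rewrite leNgt; apply/negP => h; apply: Ul.
have [->|->] : s = 1 \/ s = - 1.
- by rewrite /s; case: (odd n.-1) (signr_odd R n.-1) => <-; rewrite ?expr0 ?expr1; [right|left].
- case: (ltrgt0P (rsol (rcoef eps l) k)) h => [b0|b0|->]; last by rewrite mul0r ltxx.
    by rewrite pmulr_rgt0// => b1; left; exists k => //; rewrite !mul1r.
  by rewrite nmulr_rgt0// => b1; right; exists k => //; rewrite !mulN1r !oppr_gt0.
case: (ltrgt0P (rsol (rcoef eps l) k)) h => [b0|b0|->]; last by rewrite mul0r ltxx.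
  by rewrite pmulr_rgt0// => b1; right; exists k => //; rewrite opprK !mul1r.
by rewrite nmulr_rgt0// => b1; left; exists k => //; rewrite !mulN1r !oppr_gt0.
Qed.

(** By [alternating_norm], [|u k| + |u k.+1|] drops by exactly [a k.+1 * |u k.+1|] at each step. *)
Lemma alternates_telescope a u n k : recurrence a u -> alternates_from n u ->
  (forall k, (n < k)%N -> 0 <= a k) -> (n <= k)%N ->
  \sum_(n.+1 <= j < k.+1) a j * `|u j| + (`|u k| + `|u k.+1|) = `|u n| + `|u n.+1|.
Proof.
move=> hu hal ha /subnK <-; elim: (k - n)%N => [|j IH].
  by rewrite add0n big_geq// add0r.
rewrite addSn big_nat_recr ?ltnS ?leq_addl//= -IH -(alternating_norm hu hal ha (leq_addl j n)).
by rewrite -!addrA; congr (_ + _); ring.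
Qed.

Lemma alternates_bounded a u n : recurrence a u -> alternates_from n u ->
  (forall k, (n < k)%N -> 0 <= a k) -> exists2 C, 0 <= C & forall k, `|u k| <= C.
Proof.
move=> hu hal ha; pose S := \sum_(j < n.+1) `|u j|.
have S0 : 0 <= S by apply: sumr_ge0.
exists (`|u n| + `|u n.+1| + S) => [|k]; first by rewrite !addr_ge0.
have [kn|nk] := leqP k n.
  have kn' : (k < n.+1)%N by [].
  rewrite (le_trans (_ : _ <= S))//; last by rewrite lerDr addr_ge0.
  by rewrite /S (bigD1 (Ordinal kn'))//= lerDl sumr_ge0.
rewrite -(alternates_telescope hu hal ha (ltnW nk)).
have : 0 <= \sum_(n.+1 <= j < k.+1) a j * `|u j|.
  by rewrite big_nat; apply: sumr_ge0 => j /andP[nj _]; rewrite mulr_ge0// ha.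
have := normr_ge0 (u k.+1); lra.
Qed.

(** With [a k >= c / k], the telescoped sum dominates [c] times the tail of the series. *)
Lemma alternates_summable a u n c : recurrence a u -> alternates_from n u ->
  0 < c -> (forall k, (n < k)%N -> c * k%:R^-1 <= a k) ->
  exists C, forall N, \sum_(k < N) `|u k| / k%:R <= C.
Proof.
move=> hu hal c0 hc.
have ha k : (n < k)%N -> 0 <= a k.
  by move=> /hc; apply: le_trans; rewrite mulr_ge0 ?invr_ge0 ?ler0n// ltW.
have t0 k : 0 <= `|u k| / k%:R by rewrite divr_ge0.
exists (\sum_(0 <= k < n.+1) `|u k| / k%:R + c^-1 * (`|u n| + `|u n.+1|)) => N.
apply: le_trans (_ : \sum_(0 <= k < (n + N).+1) `|u k| / k%:R <= _).
  rewrite -(big_mkord xpredT (fun k => `|u k| / k%:R)).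
  by rewrite [leRHS](@big_cat_nat _ _ _ N)//= ?lerDl ?sumr_ge0//; lia.
rewrite (@big_cat_nat _ _ _ n.+1)//=; last by lia.
rewrite lerD2l ler_pdivlMl// -(alternates_telescope hu hal ha (leq_addr N n)).
rewrite mulr_sumr ler_wpDr ?addr_ge0//.
apply: ler_sum_nat => k /andP[nk _].
by rewrite mulrCA mulrC ler_wpM2r// hc.
Qed.

(** By strong induction every earlier [l j] lies near [j], so the element near [k] is not among them
    and [l k <= k + d]. Localisation then puts [l k] near some [i <= k], and [i < k] would give
    [l k = l i] by uniqueness. *)
Lemma listed_near_nat (E : set R) (l : nat -> R) d n : 0 < d <= 4^-1 ->
  (forall i j, (1 <= i)%N -> (i < j)%N -> l i < l j) ->
  (forall x, E x <-> exists2 m, (1 <= m)%N & x = l m) ->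
  (forall x, E x -> x < n%:R + d -> exists2 k, (0 < k <= n)%N & `|x - k%:R| < d) ->
  (forall k, (0 < k <= n)%N -> exists2 x, E x & `|x - k%:R| <= d) ->
  (forall x y k, (0 < k <= n)%N -> E x -> E y -> `|x - k%:R| <= d -> `|y - k%:R| <= d ->
    x = y) ->
  forall k, (0 < k <= n)%N -> `|l k - k%:R| <= d.
Proof.
move=> /andP[d0 d4] lmono hE hloc hex huniq k.
have [m] := ubnP k; elim: m k => // m IH k km /andP[k0 kn].
have lE j : (0 < j)%N -> E (l j) by move=> j0; apply/hE; exists j.
have [x /hE[j j0 ->{x}] hj] : exists2 x, E x & `|x - k%:R| <= d by apply: hex; rewrite k0.
have lt_nat (i i' : nat) : (i < i')%N -> i%:R + 1 <= i'%:R :> R by rewrite natr1 ler_nat.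
have kj : (k <= j)%N.
  rewrite leqNgt; apply/negP => jk.
  have : `|l j - j%:R| <= d by apply: IH; lia.
  move: hj (lt_nat _ _ jk); rewrite !ler_norml; lra.
have lkj : l k <= l j.
  by move: kj; rewrite leq_eqVlt => /predU1P[->//|kj]; rewrite ltW// lmono.
have lkd : l k <= k%:R + d by move: hj; rewrite ler_norml; lra.
(* Localisation asks for a strict inequality, so the endpoint is treated apart. *)
have [->|lne] := eqVneq (l k) (k%:R + d); first by rewrite addrAC subrr add0r ger0_norm// ltW.
have hkn : k%:R <= n%:R :> R by rewrite ler_nat.
have lkd' : l k < k%:R + d by rewrite lt_neqAle lne.
have [i /andP[i0 ilen] hi] := hloc (l k) (lE _ k0) (lt_le_trans lkd' (lerD hkn (lexx d))).
have ik : (i <= k)%N.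
  rewrite leqNgt; apply/negP => ki.
  by move: hi (lt_nat _ _ ki); rewrite ltr_norml; lra.
move: ik; rewrite leq_eqVlt => /predU1P[e|ik]; first by rewrite -{2}e ltW.
have hii : `|l i - i%:R| <= d by apply: IH; lia.
have := huniq (l i) (l k) i; rewrite i0 ilen => /(_ isT (lE _ i0) (lE _ k0) hii (ltW hi)).
by move=> h; have := lmono _ _ i0 ik; rewrite h ltxx.
Qed.

End coefficients.

(** * An integrable function is determined by its moments *)

Section moments.
Context {R : realType}.
Implicit Types (f : R -> R) (x y t : R) (m N : nat).

Notation mu := (@lebesgue_measure R).
Notation D := (`]0, 1[%classic : set R).

Lemma expr1B_ge y N : 0 <= y <= 1 -> 1 - N%:R * y <= (1 - y) ^+ N.
Proof.
move=> /andP[y0 y1]; elim: N => [|N IH]; first by rewrite mul0r subr0 expr0.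
rewrite exprS -natr1; apply: le_trans (_ : (1 - y) * (1 - N%:R * y) <= _).
  have : 0 <= N%:R * y ^+ 2 by rewrite mulr_ge0 ?exprn_ge0.
  by rewrite expr2; lra.
by rewrite ler_wpM2l// subr_ge0.
Qed.

Lemma expr1D_ge y N : 0 <= y -> 1 + N%:R * y <= (1 + y) ^+ N.
Proof.
move=> y0; elim: N => [|N IH]; first by rewrite mul0r addr0 expr0.
rewrite exprS -natr1; apply: le_trans (_ : (1 + y) * (1 + N%:R * y) <= _).
  have : 0 <= N%:R * y ^+ 2 by rewrite mulr_ge0 ?exprn_ge0.
  by rewrite expr2; lra.
by rewrite ler_wpM2l// addr_ge0.
Qed.

(** [(1 - y) (1 + y) <= 1] turns the Bernoulli bound [N y <= (1 + y)^N] into an upper bound. *)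
Lemma expr1B_le y N : 0 < y <= 1 -> (0 < N)%N -> (1 - y) ^+ N <= (N%:R * y)^-1.
Proof.
move=> /andP[y0 y1] N0; have Ny : 0 < N%:R * y by rewrite mulr_gt0// ltr0n.
rewrite -div1r ler_pdivlMr//.
have p : 0 <= (1 - y) ^+ N by rewrite exprn_ge0// subr_ge0.
apply: le_trans (_ : (1 - y) ^+ N * (1 + y) ^+ N <= _).
  by rewrite ler_wpM2l// (le_trans _ (expr1D_ge N (ltW y0)))// lerDr.
rewrite -exprMn exprn_ile1//; first by rewrite mulr_ge0; lra.
nra.
Qed.

(* [(1 - x^m)^N] with [N] about [t^-m] tends to the indicator of [x < t]. *)
Definition step_exp t m := (Num.truncn (t ^- m)).+1.

Lemma step_cvg t x : 0 < t < 1 -> 0 < x < 1 -> x != t ->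
  ((1 - x ^+ m) ^+ step_exp t m : R) @[m --> \oo] --> ((x <= t)%R%:R : R).
Proof.
move=> /andP[t0 t1] /andP[x0 x1] xt.
have tp m : 0 < t ^- m by rewrite invr_gt0 exprn_gt0.
have h1 m : t ^- m < (step_exp t m)%:R.
  by have /andP[] := truncn_itv (ltW (tp m)).
have h2 m : (step_exp t m)%:R <= t ^- m + 1.
  by rewrite /step_exp -natr1 lerD2r; have /andP[] := truncn_itv (ltW (tp m)).
have xm m : 0 < x ^+ m <= 1 by rewrite exprn_gt0// exprn_ile1// ltW.
case: (ltgtP x t) xt => // xt _ /=.
  (* For [x < t], Bernoulli gives [1 - (1 - x^m)^N <= N x^m <= (x / t)^m + x^m]. *)
  apply: (@squeeze_cvgr _ _ _ _ (fun m => 1 - ((x / t) ^+ m + x ^+ m)) (fun=> 1)).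
  - near=> m; apply/andP; split.
      have /andP[/ltW p q] := xm m.
      apply: le_trans (expr1B_ge (step_exp t m) _); last by rewrite p.
      rewrite lerD2l lerN2.
      rewrite (_ : (x / t) ^+ m + x ^+ m = (t ^- m + 1) * x ^+ m); last by rewrite expr_div_n; ring.
      by rewrite ler_wpM2r.
    rewrite exprn_ile1// ?subr_ge0; have /andP[/ltW] := xm m => //.
    by move=> p _; rewrite gerBl.
  - rewrite -[X in _ --> X]subr0 -[X in _ - X]addr0.
    apply: cvgB; first exact: cvg_cst.
    apply: cvgD; apply: cvg_expr; last by rewrite ger0_norm// ltW.
    by rewrite ger0_norm ?divr_ge0 ?ltW// ltr_pdivrMr// mul1r.
  - exact: cvg_cst.
(* For [x > t], the power is at most [1 / (N x^m) <= (t / x)^m]. *)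
apply: (@squeeze_cvgr _ _ _ _ (fun=> 0) (fun m => (t / x) ^+ m)).
- near=> m; rewrite exprn_ge0 ?subr_ge0 /=; last by have /andP[] := xm m.
  apply: le_trans (expr1B_le (xm m) _) _ => //.
  rewrite expr_div_n invfM ler_pM2r ?invr_gt0; last by have /andP[] := xm m.
  by rewrite -[leRHS]invrK lef_pV2 ?posrE ?ltr0n ?tp// ltW.
- exact: cvg_cst.
- apply: cvg_expr; rewrite ger0_norm ?divr_ge0 ?ltW//.
  by rewrite ltr_pdivrMr// mul1r.
Unshelve. all: by end_near. Qed.

Lemma continuous_measurable_D f : continuous f -> measurable_fun D f.
Proof. by move=> /continuous_measurable_fun; exact: measurable_funTS. Qed.

Lemma integrable_mul_continuous f (q : R -> R) : mu.-integrable D (EFin \o f) ->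
  continuous q -> mu.-integrable D (EFin \o (fun x => f x * q x)).
Proof.
move=> fi qc.
have [M [_ hM]] : bounded_set (q @` `[0, 1]%classic).
  apply: compact_bounded; apply: continuous_compact; last exact: segment_compact.
  exact: continuous_subspaceT.
have := @integrableMl _ _ _ mu D (measurable_itv _) (EFin \o f) q fi.
move=> /(_ (continuous_measurable_D qc)); apply.
exists (M + 1); split; first by rewrite num_real.
move=> y My x /= Dx; apply: hM.
  by rewrite (lt_trans _ My)// ltrDl.
by exists x => //=; move: Dx; rewrite !in_itv /= => /andP[/ltW -> /ltW ->].
Qed.

Lemma moments_poly_eq0 f (p : {poly R}) : mu.-integrable D (EFin \o f) ->
  (forall i, \int[mu]_(x in D) (f x * x ^+ i) = 0) ->
  \int[mu]_(x in D) (f x * p.[x]) = 0.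
Proof.
elim/poly_ind: p f => [|p c IH] f fi f0.
  under eq_Rintegral do rewrite horner0 mulr0.
  by rewrite Rintegral_cst// mul0r.
have fXi : mu.-integrable D (EFin \o (fun x => f x * x)).
  by apply: integrable_mul_continuous => // x; exact: cvg_id.
under eq_Rintegral do rewrite hornerMXaddC mulrDr mulrA -mulrAC.
rewrite RintegralD//=; last 2 first.
- apply: (integrable_mul_continuous fXi).
  exact: continuous_horner.
- by apply: integrable_mul_continuous => // x; exact: cvg_cst.
rewrite IH ?add0r//; last first.
  by move=> i; under eq_Rintegral do rewrite -mulrA -exprS; exact: f0.
rewrite RintegralZr//.
have := f0 0%N; under eq_Rintegral do rewrite expr0 mulr1.
by move=> ->; rewrite mul0r.
Qed.

(** The polynomials of [step_cvg] take values in [[0, 1]], so their integrals against [f], all [0],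
    pass to the limit by dominated convergence. *)
Lemma moments_prefix_eq0 f t : 0 < t < 1 -> mu.-integrable D (EFin \o f) ->
  (forall i, \int[mu]_(x in D) (f x * x ^+ i) = 0) ->
  \int[mu]_(x in D) (f x * (x <= t)%R%:R) = 0.
Proof.
move=> t01 fi f0.
pose p m : {poly R} := (1 - 'X^m) ^+ step_exp t m.
have pE m x : (p m).[x] = (1 - x ^+ m) ^+ step_exp t m.
  by rewrite /p horner_exp !hornerE.
have mf : measurable_fun D f.
  by apply/measurable_EFinP; exact: measurable_int fi.
have mle : measurable_fun D (fun x : R => (x <= t)%R%:R : R).
  apply: (@measurableT_comp _ _ _ _ _ _ (fun b : bool => b%:R : R)) => //.
  exact: measurable_fun_ler.
have [] := @dominated_convergence _ _ R mu D (measurable_itv _)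
  (fun m x => (f x * (p m).[x])%:E) (fun x => (f x * (x <= t)%R%:R)%:E)
  (abse \o (EFin \o f)).
- move=> m; apply/measurable_EFinP/measurable_funM => //.
  exact: continuous_measurable_D (@continuous_horner _ (p m)).
- exact/measurable_EFinP/measurable_funM.
(* [step_cvg] leaves out [x = t], a null set. *)
- exists [set t]; split; [exact: measurable_set1|exact: lebesgue_measure_set1|].
  move=> x /= nc; apply/eqP/negPn/negP => xt; apply: nc.
  rewrite in_itv => x01; apply: cvg_EFin; first by near=> m.
  apply: cvgM; first exact: cvg_cst.
  by under eq_fun do rewrite pE; apply: step_cvg.
- exact: integrable_abse.
- apply: aeW => x m /=; rewrite in_itv /= => /andP[x0 x1].
  rewrite lee_fin normrM ler_piMr// pE normrX exprn_ile1//.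
  have : 0 <= x ^+ m <= 1 by rewrite exprn_ge0 ?exprn_ile1 ?(ltW x0) ?(ltW x1).
  by rewrite ler_norml => /andP[]; lra.
move=> _ _ h; rewrite /Rintegral.
have -> : (\int[mu]_(x in D) (f x * (x <= t)%R%:R)%:E = 0)%E; last by [].
apply: cvg_unique h _ => //.
apply: cvg_near_cst; near=> m.
have := moments_poly_eq0 (p m) fi f0; rewrite /Rintegral => h.
rewrite -[LHS]fineK; first by rewrite h.
apply: integrable_fin_num => //; apply: integrable_mul_continuous => //.
exact: continuous_horner.
Unshelve. all: by end_near. Qed.

(** The integral of [f] up to [y] vanishes for every [y] in []0, 1[], and by Lebesgue
    differentiation its derivative is [f] almost everywhere. *)
Lemma moments_ae_eq0 f : mu.-integrable D (EFin \o f) ->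
  (forall i, \int[mu]_(x in D) (f x * x ^+ i) = 0) ->
  {ae mu, forall x, D x -> f x = 0}.
Proof.
move=> fi f0.
have gi : mu.-integrable setT (EFin \o (f \_ D)).
  by rewrite -restrict_EFin; apply/(integrable_mkcond _ _).1.
have gI y : mu.-integrable [set` Interval (BRight 0) (BRight y)] (EFin \o (f \_ D)).
  by apply: integrableS gi.
have := FTC1 gI (integrable_locally (measurable_itv _) fi).
apply: filterS; first exact: (ae_filter_ringOfSetsType mu).
move=> x + Dx; move: (Dx); rewrite /= in_itv /= => /andP[x0 x1].
move=> /(_ x0) [_]; rewrite patchE mem_set// => <-.
rewrite derive1E (_ : 'D_1 _ x = 'D_1 (cst (0 : R)) x); first exact: derive_cst.
apply: near_eq_derive; near=> y.
have y0 : 0 < y by near: y; exact: lt_nbhsr.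
have y1 : y < 1 by near: y; exact: lt_nbhsl.
apply: etrans (moments_prefix_eq0 (t := y) _ fi f0); last by rewrite y0.
rewrite [LHS]Rintegral_mkcond [RHS]Rintegral_mkcond.
apply: eq_Rintegral => z _.
rewrite !patchE.
have [Dz|Dz] := boolP (z \in D); last by rewrite if_same.
have : 0 < z by move: Dz; rewrite inE /= in_itv /= => /andP[].
move=> z0; rewrite (_ : (z \in _) = (z <= y)); last first.
  by apply/idP/idP; rewrite inE /= in_itv /= z0.
by case: (z <= y); rewrite ?mulr1 ?mulr0.
Unshelve. all: by end_near. Qed.

End moments.

(** * The weight and the operator on real functions *)

Section weights.
Context {R : realType}.
Implicit Types (eps x : R) (v : R -> R) (m n : nat).

Notation mu := (@lebesgue_measure R).
Notation D := (`]0, 1[%classic : set R).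

(** The weight without its singular factor [x^-1]. Integrals are taken against it because the test
    functions carry a factor [x]. *)
Definition density eps x : R := (1 - x) `^ (eps^-1) * (1 + x) `^ (- eps^-1).

Lemma weightE eps x : weight eps x = x^-1 * density eps x.
Proof. by rewrite /weight /density mulrA. Qed.

Lemma pcoefE eps x : 0 < eps -> 0 <= x <= 1 ->
  pcoef eps x = (1 - x ^+ 2) * density eps x.
Proof.
move=> e0 /andP[x0 x1]; rewrite /pcoef /density.
have ei : 0 < eps^-1 by rewrite invr_gt0.
rewrite !powRD; last 2 first.
- by apply/implyP => _; rewrite gt_eqF//; lra.
- by rewrite gt_eqF// addr_gt0.
rewrite !powRr1; [ring|lra|lra].
Qed.

Lemma density_ge0 eps x : 0 <= density eps x.
Proof. by rewrite mulr_ge0// powR_ge0. Qed.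

Lemma density_gt0 eps x : 0 <= x < 1 -> 0 < density eps x.
Proof. by move=> /andP[x0 x1]; rewrite mulr_gt0// powR_gt0//; lra. Qed.

(** This is where [eps <= 1/4] enters. The fourth power makes the squared norm of [x^k] at most of
    order [k^-4], so that [k] times the norm tends to [0]. *)
Lemma density_le eps x : 0 < eps <= 4^-1 -> 0 <= x <= 1 -> density eps x <= (1 - x) ^+ 4.
Proof.
move=> /andP[e0 e4] /andP[x0 x1].
have e4' : 4 <= eps^-1 by rewrite -[leLHS]invrK lef_pV2 ?posrE ?invr_gt0.
rewrite /density -[leRHS]mulr1 ler_pM ?powR_ge0//.
  move: x1; rewrite le_eqVlt => /predU1P[->|x1].
    by rewrite subrr powR0 ?expr0n// gt_eqF ?invr_gt0.
  by rewrite -powR_mulrn ?ger_powR//; lra.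
by rewrite -[leRHS](powRr0 (1 + x)) ler_powR//; lra.
Qed.

Lemma is_derive_density eps x : - 1 < x < 1 ->
  is_derive x (1 : R) (density eps) (- 2 * eps^-1 / (1 - x ^+ 2) * density eps x).
Proof.
move=> /andP[x0 x1].
have p1 : 0 < 1 - x by lra.
have p2 : 0 < 1 + x by lra.
have d1 : is_derive x (1 : R) (fun y => (1 - y) `^ eps^-1)
    (eps^-1 * (1 - x) `^ (eps^-1 - 1) * - 1).
  apply: (@is_derive1_comp _ (@powR R ^~ eps^-1) (fun y => 1 - y)).
    exact: is_derive1_powR.
  by apply: is_derive_eq; ring.
have d2 : is_derive x (1 : R) (fun y => (1 + y) `^ (- eps^-1))
    (- eps^-1 * (1 + x) `^ (- eps^-1 - 1) * 1).
  apply: (@is_derive1_comp _ (@powR R ^~ (- eps^-1)) (fun y => 1 + y)).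
    exact: is_derive1_powR.
  by apply: is_derive_eq; ring.
rewrite /density; apply: is_derive_eq; rewrite /GRing.scale /=.
have pE y a : 0 < y -> y `^ (a - 1) = y `^ a / y.
  by move=> y0; rewrite powRD ?powRN ?powRr1 ?(ltW y0)// (gt_eqF y0) implybT.
rewrite !pE//; set a := eps^-1; field; rewrite !gt_eqF//; nra.
Qed.

(** The body of [smooth01] with its witness exposed, so that formulas can name the derivatives. *)
Definition derivatives01 v (Ds : nat -> R -> R) :=
  [/\ forall x, x \in `[0, 1] -> Ds 0%N x = v x,
      forall k, {within `[0, 1], continuous (Ds k)}
    & forall k x, x \in `]0, 1[ -> is_derive x 1 (Ds k) (Ds k.+1 x)].

Lemma near_itv01 x : x \in `]0, 1[ -> \forall y \near x, y \in `]0, (1 : R)[.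
Proof. by move=> x01; apply: near_in_itvoo. Qed.

Lemma derivatives01_derive1 v Ds x : derivatives01 v Ds -> x \in `]0, 1[ ->
  derive1 v x = Ds 1%N x.
Proof.
move=> [h0 _ h1] x01; rewrite derive1E.
have := h1 0%N x x01 => -[_ <-].
apply: near_eq_derive; near=> y.
rewrite h0//; have : y \in `]0, (1:R)[ by near: y; exact: near_itv01.
by rewrite !in_itv /= => /andP[/ltW -> /ltW ->].
Unshelve. all: by end_near. Qed.

Lemma is_derive_pcoef_mul eps (h : R -> R) x dh : 0 < eps -> x \in `]0, 1[ ->
  is_derive x (1 : R) h dh ->
  is_derive x (1 : R) (fun y => (1 - y ^+ 2) * density eps y * h y)
    (density eps x * ((1 - x ^+ 2) * dh - 2 * (x + eps^-1) * h x)).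
Proof.
rewrite in_itv /= => e0 /andP[x0 x1] hh.
have hd : is_derive x (1 : R) (density eps) (- 2 * eps^-1 / (1 - x ^+ 2) * density eps x).
  by apply: is_derive_density; rewrite x1; lra.
apply: is_derive_eq; rewrite /GRing.scale /=; field.
rewrite gt_eqF//=; nra.
Qed.

Definition realL0 eps v x : R :=
  - (eps / 2) * (weight eps x)^-1 * derive1 (fun y => pcoef eps y * derive1 v y) x.

(** The operator expanded, with the density divided out; this form is continuous up to both
    endpoints. *)
Definition L0_of eps (Ds : nat -> R -> R) x : R :=
  - (eps / 2) * (x * ((1 - x ^+ 2) * Ds 2%N x - 2 * (x + eps^-1) * Ds 1%N x)).

Lemma realL0E eps v Ds x : 0 < eps -> derivatives01 v Ds -> x \in `]0, 1[ ->
  realL0 eps v x = L0_of eps Ds x.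
Proof.
move=> e0 hv x01; have [_ _ /(_ 1%N x x01) h2] := hv.
have := is_derive_pcoef_mul e0 x01 h2 => -[_ h].
rewrite /realL0 derive1E (_ : 'D_1 _ x = density eps x *
    ((1 - x ^+ 2) * Ds 2%N x - 2 * (x + eps^-1) * Ds 1%N x)); last first.
  rewrite -h; apply: near_eq_derive; near=> y.
  have y01 : y \in `]0, (1:R)[ by near: y; exact: near_itv01.
  rewrite (derivatives01_derive1 hv)// pcoefE//.
  by move: y01; rewrite in_itv /= => /andP[/ltW -> /ltW ->].
have := x01; rewrite in_itv /= => /andP[x0 x1].
have r0 : 0 < density eps x by rewrite density_gt0// x1 ltW.
by rewrite weightE /L0_of; field; rewrite !gt_eqF.
Unshelve. all: by end_near. Qed.

Lemma density_within eps : 0 < eps <= 4^-1 -> {within `[0, 1], continuous (density eps)}.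
Proof.
move=> he; have hc x : - 1 < x < 1 -> {for x, continuous (density eps)}.
  move=> /is_derive_density -/(_ eps)[h _].
  exact/differentiable_continuous/derivable1_diffP.
apply/continuous_within_itvP => //; split.
- by move=> x; rewrite in_itv /= => /andP[x0 x1]; apply: hc; lra.
- by apply: cvg_at_right_filter; apply: hc; lra.
have -> : density eps 1 = 0.
  rewrite /density subrr powR0 ?mul0r//; have /andP[e0 _] := he.
  by rewrite gt_eqF// invr_gt0.
apply: (@squeeze_cvgr _ _ _ _ (fun=> 0) (fun x => (1 - x) ^+ 4)).
- near=> x; rewrite density_ge0 density_le//.
  by apply/andP; split; [near: x; exact: nbhs_left_ge|near: x; exact: nbhs_left_le].
- exact: cvg_cst.
apply: cvg_at_left_filter.
have -> : 0 = (fun x : R => (1 - x) ^+ 4) 1 by rewrite subrr expr0n.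
apply: (@continuous_comp _ _ _ (fun x => 1 - x) (fun x => x ^+ 4)).
  by apply: cvgB; [exact: cvg_cst|exact: cvg_id].
exact: exprn_continuous.
Unshelve. all: by end_near. Qed.

Lemma within_integrable (f g : R -> R) : {within `[0, 1], continuous g} ->
  {in D, f =1 g} -> mu.-integrable D (EFin \o f).
Proof.
move=> gc fg; apply: (@eq_integrable _ _ _ mu D (measurable_itv _) (EFin \o g)).
  by move=> x Dx; rewrite /= fg.
apply: (@integrableS _ _ _ mu `[0, 1]%classic) => //.
  by apply: subset_itv; rewrite bnd_simp.
by apply: continuous_compact_integrable => //; exact: segment_compact.
Qed.

(** The operator takes a polynomial [q] to [x] times this polynomial; leaving out [x] matches
    integration against [density]. *)
Definition Mop eps (q : {poly R}) : {poly R} :=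
  - (eps / 2) *: ((1 - 'X^2) * q^`()^`() - 2 *: (('X + (eps^-1)%:P) * q^`())).

Lemma MopE eps (q : {poly R}) x : (Mop eps q).[x] =
  - (eps / 2) * ((1 - x ^+ 2) * q^`()^`().[x] - 2 * (x + eps^-1) * q^`().[x]).
Proof.
rewrite /Mop -polyC1 !(hornerZ, hornerN, hornerM, hornerD, hornerX, hornerXn, hornerC). ring.
Qed.

Lemma horner_within (q : {poly R}) : {within `[0, 1], continuous (horner q)}.
Proof. apply: continuous_subspaceT; exact: continuous_horner. Qed.

Lemma withinM (f g : R -> R) : {within `[0, 1], continuous f} ->
  {within `[0, 1], continuous g} -> {within `[0, 1], continuous (fun x => f x * g x)}.
Proof. by move=> fc gc x; apply: cvgM; [exact: fc|exact: gc]. Qed.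

Lemma withinB (f g : R -> R) : {within `[0, 1], continuous f} ->
  {within `[0, 1], continuous g} -> {within `[0, 1], continuous (fun x => f x - g x)}.
Proof. by move=> fc gc x; apply: cvgB; [exact: fc|exact: gc]. Qed.

Lemma horner_within_ext (p : {poly R}) (f : R -> R) : horner p =1 f ->
  {within `[0, 1], continuous f}.
Proof. by move=> /funext <-; exact: horner_within. Qed.

Lemma onem_sqr_within : {within `[0, 1], continuous (fun x : R => 1 - x ^+ 2)}.
Proof. by apply: (@horner_within_ext (1 - 'X^2)) => x; rewrite !hornerE. Qed.

Lemma drift_within eps : {within `[0, 1], continuous (fun x : R => 2 * (x + eps^-1))}.
Proof. by apply: (@horner_within_ext (2 *: ('X + eps^-1%:P))) => x; rewrite !hornerE. Qed.

Lemma L0_of_within eps (Ds : nat -> R -> R) : (forall k, {within `[0, 1], continuous (Ds k)}) ->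
  {within `[0, 1], continuous (L0_of eps Ds)}.
Proof.
move=> dc; apply: withinM.
  by apply: (@horner_within_ext (- (eps / 2))%:P) => x; rewrite hornerC.
apply: withinM; first by apply: (@horner_within_ext 'X) => x; rewrite hornerX.
by apply: withinB; apply: withinM => //; [exact: onem_sqr_within|exact: drift_within].
Qed.

Lemma Rintegral_itv_cc (f g : R -> R) : {within `[0, 1], continuous g} ->
  {in D, f =1 g} -> \int[mu]_(x in D) f x = \int[mu]_(x in `[0, 1]) g x.
Proof.
move=> gc fg; transitivity (\int[mu]_(x in D) g x); first exact: eq_Rintegral.
rewrite /Rintegral; congr fine.
apply/esym/integral_itv_bndoo; apply/measurable_EFinP.
apply: (measurable_funS (measurable_itv `[0, 1])).
  by apply: subset_itv; rewrite bnd_simp.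
exact: subspace_continuous_measurable_fun.
Qed.

(** Green's formula for [v] and [q = x s]. The boundary term [p (v' q - v q')] vanishes at [1]
    through [1 - x^2], and at [0] because [v] and [q] do. *)
Lemma realL0_symm eps v Ds (s : {poly R}) : 0 < eps <= 4^-1 ->
  derivatives01 v Ds -> v 0 = 0 ->
  \int[mu]_(x in D) (realL0 eps v x * (density eps x * s.[x])) =
  \int[mu]_(x in D) (v x * (density eps x * (Mop eps ('X * s)).[x])).
Proof.
move=> he hv v0; have /andP[e0 _] := he; have [h0 h1 h2] := hv.
pose q : {poly R} := 'X * s.
pose H x := Ds 1%N x * q.[x] - Ds 0%N x * q^`().[x].
pose dH x := Ds 2%N x * q.[x] - Ds 0%N x * q^`()^`().[x].
have Hc : {within `[0, 1], continuous H}.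
  by apply: withinB; apply: withinM => //; exact: horner_within.
(* [A] and [B] are [(p v')' q] and [v (p q')']; they differ by the derivative of [p] times the
   Wronskian [H]. *)
pose A x := density eps x * ((1 - x ^+ 2) * Ds 2%N x - 2 * (x + eps^-1) * Ds 1%N x) * q.[x].
pose B x := density eps x * Ds 0%N x * ((1 - x ^+ 2) * q^`()^`().[x]
              - 2 * (x + eps^-1) * q^`().[x]).
have c1 := onem_sqr_within; have c2 := @drift_within eps.
have Ac : {within `[0, 1], continuous A}.
  apply: withinM; last exact: horner_within.
  apply: withinM; first exact: density_within.
  by apply: withinB; apply: withinM.
have Bc : {within `[0, 1], continuous B}.
  apply: withinM; first by apply: withinM => //; exact: density_within.
  by apply: withinB; apply: withinM => //; exact: horner_within.
have AB0 : \int[mu]_(x in `[0, 1]) (A x - B x) = 0.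
  pose W x : R := (1 - x ^+ 2) * density eps x * H x.
  have Wc : {within `[0, 1], continuous W}.
    by apply: withinM => //; apply: withinM => //; exact: density_within.
  have Wd x : x \in `]0, 1[ -> is_derive x (1 : R) W (A x - B x).
    move=> x01; have d0 := h2 0%N x x01; have d1 := h2 1%N x x01.
    have dHx : is_derive x (1 : R) H (dH x).
      by apply: is_derive_eq; rewrite /GRing.scale /= /dH; ring.
    apply: (is_derive_eq (is_derive_pcoef_mul e0 x01 dHx)).
    by rewrite /A /B /H /dH; ring.
  have Wder : derivable_oo_LRcontinuous W 0 1.
    have [_ Wl Wr] := (continuous_within_itvP W ltr01).1 Wc.
    by split => // x /Wd[].
  have W' : {in `]0, 1[, derive1 W =1 (fun x => A x - B x)}.
    by move=> x /Wd[_]; rewrite derive1E.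
  rewrite /Rintegral (continuous_FTC2 ltr01 (withinB Ac Bc) Wder W') /=.
  have -> : W 1 = 0 by rewrite /W expr1n subrr !mul0r.
  have -> : W 0 = 0; last by rewrite subrr.
  rewrite /W /H h0 ?in_itv /= ?lexx ?ler01// v0 /q hornerM hornerX; ring.
have AL x : x \in D -> realL0 eps v x * (density eps x * s.[x]) = - (eps / 2) * A x.
  by rewrite inE => x01; rewrite (realL0E e0 hv)// /L0_of /A /q hornerM hornerX; ring.
have BL x : x \in D -> v x * (density eps x * (Mop eps q).[x]) = - (eps / 2) * B x.
  rewrite inE /= => x01; rewrite -h0.
    by rewrite /B MopE; ring.
  by move: x01; rewrite !in_itv /= => /andP[/ltW -> /ltW ->].
transitivity (\int[mu]_(x in D) (- (eps / 2) * A x)); first exact: eq_Rintegral.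
transitivity (\int[mu]_(x in D) (- (eps / 2) * B x)); last by apply/esym/eq_Rintegral.
have Ai : mu.-integrable D (EFin \o A) by exact: within_integrable Ac _.
have Bi : mu.-integrable D (EFin \o B) by exact: within_integrable Bc _.
rewrite !RintegralZl//; congr (_ * _).
apply/eqP; rewrite -subr_eq0 -RintegralB//.
by rewrite (@Rintegral_itv_cc _ (fun x => A x - B x)) ?AB0//; exact: withinB.
Qed.

End weights.

(** * Eigenvalues give decaying solutions *)

Section necessary.
Context {R : realType}.
Implicit Types (eps x l : R) (g h : R -> R) (i m n : nat).

Notation mu := (@lebesgue_measure R).
Notation D := (`]0, 1[%classic : set R).

(** [(n + 1) x^n <= 1 + x + ... + x^n], and multiplying by [1 - x] leaves [1 - x^(n+1)]. *)
Lemma exprMonem_le x n : 0 <= x <= 1 -> x ^+ n * (1 - x) <= n.+1%:R^-1.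
Proof.
move=> /andP[x0 x1]; rewrite -[leRHS]mul1r ler_pdivlMr ?ltr0n//.
have h : n.+1%:R * x ^+ n * (1 - x) <= 1 - x ^+ n.+1.
  elim: n => [|n IH]; first by rewrite expr0 expr1 !mul1r.
  rewrite -natr1 mulrDl mul1r mulrDl exprS.
  have : x * (n.+1%:R * x ^+ n * (1 - x)) <= x * (1 - x ^+ n.+1) by rewrite ler_wpM2l.
  have : x * x ^+ n <= 1 by rewrite -exprS exprn_ile1.
  rewrite !exprS; set y := x ^+ n; set c := n.+1%:R => hy h1.
  have : 0 <= (1 - x) * (1 - x * y).
    by rewrite mulr_ge0 ?subr_ge0.
  nra.
by rewrite mulrC mulrA (le_trans h)// gerBl exprn_ge0.
Qed.

(** The square of the previous bound at [n./2], with [2 (n./2 + 1) >= n + 1]. *)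
Lemma exprMonem2_le x n : 0 <= x <= 1 -> x ^+ n * (1 - x) ^+ 2 <= 4 / n.+1%:R ^+ 2.
Proof.
move=> x01; have /andP[x0 x1] := x01.
apply: le_trans (_ : (n./2.+1%:R^-1) ^+ 2 <= _).
  apply: le_trans (_ : (x ^+ n./2 * (1 - x)) ^+ 2 <= _).
    rewrite exprMn -exprM ler_wpM2r ?exprn_ge0 ?subr_ge0// ler_wiXn2l//; lia.
  by rewrite lerXn2r ?nnegrE ?mulr_ge0 ?exprn_ge0 ?subr_ge0 ?invr_ge0// exprMonem_le.
rewrite (_ : 4 = 2 ^+ 2); last by ring.
rewrite -expr_div_n lerXn2r ?nnegrE ?divr_ge0 ?invr_ge0//.
rewrite ler_pdivlMr ?ltr0n// ler_pdivrMl ?ltr0n// -natrM ler_nat; lia.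
Qed.

Lemma expr2Monem4_le x n : 0 <= x <= 1 ->
  x ^+ n.*2 * (1 - x) ^+ 4 <= 16 / n.+1%:R ^+ 4.
Proof.
move=> x01; have /andP[x0 x1] := x01.
have -> : x ^+ n.*2 * (1 - x) ^+ 4 = (x ^+ n * (1 - x) ^+ 2) ^+ 2.
  by rewrite exprMn -!exprM muln2.
have -> : 16 / n.+1%:R ^+ 4 = (4 / n.+1%:R ^+ 2) ^+ 2 :> R.
  by rewrite expr_div_n -exprM; congr (_ / _); ring.
by rewrite lerXn2r ?nnegrE ?mulr_ge0 ?exprn_ge0 ?subr_ge0 ?invr_ge0 ?exprn_ge0// exprMonem2_le.
Qed.

Lemma weight_ge0 eps x : 0 <= x -> 0 <= weight eps x.
Proof. by move=> x0; rewrite weightE mulr_ge0 ?invr_ge0 ?density_ge0. Qed.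

Lemma expr_weight_le eps x n : 0 < eps <= 4^-1 -> 0 < x < 1 ->
  x ^+ n.*2.+2 * weight eps x <= 16 / n.+1%:R ^+ 4.
Proof.
move=> he /andP[x0 x1]; have x01 : 0 <= x <= 1 by rewrite !ltW.
apply: le_trans _ (expr2Monem4_le n x01).
rewrite weightE !(exprS x) (_ : _ * _ = (x ^+ n.*2) * (x * density eps x)); last first.
  by field; rewrite gt_eqF.
rewrite ler_wpM2l ?exprn_ge0 ?(ltW x0)//.
by apply: le_trans _ (density_le he x01); rewrite ler_piMl ?density_ge0// ltW.
Qed.

Definition wsqr_int eps h := (\int[mu]_(x in D) (h x ^+ 2 * weight eps x)%:E)%E.

Lemma measurable_density eps : measurable_fun D (density eps).
Proof.
by apply: measurable_funM; apply: (measurableT_comp (measurable_powR _));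
  [apply: measurable_funB|apply: measurable_funD].
Qed.

Lemma measurable_weight eps : measurable_fun D (weight eps).
Proof.
apply: measurable_funM; last first.
  apply: (measurableT_comp (measurable_powR _)); exact: measurable_funD.
apply: measurable_funM; last first.
  apply: (measurableT_comp (measurable_powR _)); exact: measurable_funB.
apply: open_continuous_measurable_fun; first exact: interval_open.
by move=> x; rewrite inE /= in_itv /= => /andP[x0 _]; apply: inv_continuous; rewrite gt_eqF.
Qed.

Lemma wsqr_integrable eps h : measurable_fun D h -> (wsqr_int eps h < +oo)%E ->
  mu.-integrable D (EFin \o (fun x => h x ^+ 2 * weight eps x)).
Proof.
move=> mh hi; apply/integrableP; split.
  apply/measurable_EFinP/measurable_funM; last exact: measurable_weight.
  exact: measurable_funX.
apply: le_lt_trans hi; rewrite le_eqVlt; apply/orP; left; apply/eqP.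
apply: eq_integral => x; rewrite inE /= in_itv /= => /andP[/ltW x0 _].
by rewrite ger0_norm// mulr_ge0 ?exprn_even_ge0 ?weight_ge0.
Qed.

(** Young's inequality [2 |h| y <= s h^2 + y^2 / s] with [y = x^(i+1)], integrated against the
    weight. The free parameter [s] does the work of Cauchy-Schwarz. *)
Lemma wsqr_int_bound eps h i B s : 0 < eps <= 4^-1 -> measurable_fun D h ->
  (wsqr_int eps h <= B%:E)%E -> 0 < s ->
  mu.-integrable D (EFin \o (fun x => h x * (density eps x * x ^+ i))) /\
  \int[mu]_(x in D) `|h x * (density eps x * x ^+ i)| <=
    (s * B + 16 / i.+1%:R ^+ 4 / s) / 2.
Proof.
move=> he mh hB s0.
have hi := wsqr_integrable mh (le_lt_trans hB (ltry _)).
set c := 16 / _.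
pose G x := s / 2 * (h x ^+ 2 * weight eps x) + c / s / 2.
have hG x : D x -> `|h x * (density eps x * x ^+ i)| <= G x.
  rewrite /= in_itv /= => x01; have /andP[x0 x1] := x01.
  have -> : density eps x * x ^+ i = weight eps x * x ^+ i.+1.
    by rewrite weightE exprS; field; rewrite gt_eqF.
  have w0 : 0 <= weight eps x by rewrite weight_ge0// ltW.
  have y0 : 0 <= x ^+ i.+1 by rewrite exprn_ge0// ltW.
  rewrite normrM (ger0_norm (mulr_ge0 w0 y0)).
  have := expr_weight_le i he x01; rewrite -/c.
  rewrite (_ : i.*2.+2 = (i.+1 * 2)%N); last by lia.
  rewrite exprM; move: y0; set y := x ^+ i.+1 => y0 hc.
  rewrite /G -[h x ^+ 2]real_normK ?num_real//; set a := `|h x|.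
  have : 0 <= (s * a - y) ^+ 2 by rewrite exprn_even_ge0.
  move=> sq; rewrite -(ler_pM2l s0).
  have -> : s * (s / 2 * (a ^+ 2 * weight eps x) + c / s / 2) =
    (s ^+ 2 * a ^+ 2 * weight eps x + c) / 2 by field; rewrite gt_eqF.
  have : 0 <= (s * a - y) ^+ 2 * weight eps x by rewrite mulr_ge0.
  by move: hc; nra.
have ci : mu.-integrable D (fun=> (c / s / 2)%:E).
  by apply: (@within_integrable _ _ (cst (c / s / 2))) => // y; exact: cvg_cst.
have si : mu.-integrable D (fun x => (s / 2)%:E * (h x ^+ 2 * weight eps x)%:E)%E.
  exact: integrableZl.
have Gi : mu.-integrable D (EFin \o G) by exact: integrableD si ci.
have mf : measurable_fun D (fun x => h x * (density eps x * x ^+ i)).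
  apply: measurable_funM => //; apply: measurable_funM; first exact: measurable_density.
  exact: measurable_funX.
have fi : mu.-integrable D (EFin \o (fun x => h x * (density eps x * x ^+ i))).
  apply: (le_integrable _ _ _ Gi) => //; first exact/measurable_EFinP.
  by move=> y Dy; rewrite lee_fin (le_trans (hG y Dy))// ler_norm.
split => //.
apply: le_trans (_ : \int[mu]_(x in D) G x <= _).
  by apply: le_Rintegral => //; exact: integrable_norm.
rewrite RintegralD//= RintegralZl//= Rintegral_cst//.
have -> : fine (mu D) = 1 by rewrite lebesgue_measure_itv /= lte_fin ltr01 oppr0 adde0.
have : \int[mu]_(x in D) (h x ^+ 2 * weight eps x) <= B.
  by rewrite -lee_fin /Rintegral fineK//; exact: integrable_fin_num hi.
move=> hle; have sI : s / 2 * \int[mu]_(x in D) (h x ^+ 2 * weight eps x) <= s / 2 * B.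
  by rewrite ler_wpM2l// divr_ge0// ltW.
apply: le_trans (lerD sI (lexx _)) _; rewrite mulr1 [leRHS]mulrDl.
by rewrite mulrAC.
Qed.

(** [wsqr_int_bound] with [i = 0], [B = t^-2] and [s = t] gives [17 / (2 t) <= 9 / t]. *)
Lemma wsqr_int_poly_bound eps h (q : {poly R}) C t : 0 < eps <= 4^-1 ->
  measurable_fun D h -> (forall x, x \in `]0, 1[ -> `|q.[x]| <= C) -> 0 < t ->
  (wsqr_int eps h <= (t ^- 2)%:E)%E ->
  mu.-integrable D (EFin \o (fun x => h x * (density eps x * q.[x]))) /\
  `|\int[mu]_(x in D) (h x * (density eps x * q.[x]))| <= C * 9 / t.
Proof.
move=> he mh hq t0 hB; have [hi hle] := wsqr_int_bound 0 he mh hB t0.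
have fi : mu.-integrable D (EFin \o (fun x => h x * (density eps x * q.[x]))).
  have := integrable_mul_continuous hi (@continuous_horner _ q).
  apply: eq_integrable => // x _ /=.
  by rewrite expr0 mulr1 mulrA.
split => //; apply: le_trans (le_normr_Rintegral _ fi) _ => //.
apply: le_trans (_ : \int[mu]_(x in D) (C * `|h x * (density eps x * x ^+ 0)|) <= _).
  apply: le_Rintegral => //; first exact: integrable_norm.
    by apply: (integrableZl _ C (integrable_norm hi)).
  move=> x Dx; rewrite expr0 mulr1 mulrA normrM mulrC ler_wpM2r//.
  exact: hq.
rewrite RintegralZl//; last exact: integrable_norm.
have C0 : 0 <= C.
  by apply: le_trans (hq 2^-1 _) => //; rewrite in_itv /=; lra.
rewrite -mulrA ler_wpM2l// (le_trans hle)// expr1n divr1.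
have -> : t * t ^- 2 = t^-1 by field; rewrite gt_eqF.
by have := invr_ge0 t; rewrite (ltW t0); lra.
Qed.

Lemma poly_bounded01 (q : {poly R}) :
  exists2 C, 0 < C & forall x, x \in `]0, 1[ -> `|q.[x]| <= C.
Proof.
have [M [_ hM]] : bounded_set (horner q @` `[0, 1]%classic).
  apply: compact_bounded; apply: continuous_compact; last exact: segment_compact.
  exact: horner_within.
exists (`|M| + 1); first by rewrite ltr_wpDl.
move=> x; rewrite in_itv /= => /andP[/ltW x0 /ltW x1]; apply: hM.
  by rewrite (le_lt_trans (ler_norm _))// ltrDl.
by exists x => //=; rewrite in_itv /= x0.
Qed.

Lemma measurable_smooth01 (v : R -> R) : smooth01 v -> measurable_fun D v.
Proof.
move=> [Ds [h0 h1 h2]]; apply/measurable_EFinP.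
apply: measurable_int (within_integrable (h1 0%N) _) => x.
by rewrite inE /= !in_itv /= => /andP[/ltW x0 /ltW x1]; rewrite h0// in_itv /= x0.
Qed.

Lemma measurable_realL0 eps (v : R -> R) : 0 < eps -> smooth01 v ->
  measurable_fun D (realL0 eps v).
Proof.
move=> e0 [Ds hDs]; have [_ dc _] := hDs.
apply/measurable_EFinP.
apply: measurable_int (within_integrable (@L0_of_within R eps Ds dc) _) => x.
by rewrite inE /= => x01; exact: realL0E.
Qed.

(** The symmetry identity for the approximants [v k] passes to the limit, which gives the eigenvalue
    equation for [g] in weak form. *)
Lemma eigen_weak eps l g (v : nat -> R -> R) (s : {poly R}) : 0 < eps <= 4^-1 ->
  measurable_fun D g -> (wsqr_int eps g < +oo)%E ->
  (forall k, exists Ds, derivatives01 (v k) Ds) -> (forall k, v k 0 = 0) ->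
  (forall e, 0 < e -> \forall k \near \oo,
     (wsqr_int eps (fun x => (v k x - g x)%R) <= e%:E)%E) ->
  (forall e, 0 < e -> \forall k \near \oo,
     (wsqr_int eps (fun x => (realL0 eps (v k) x - l * g x)%R) <= e%:E)%E) ->
  l * (\int[mu]_(x in D) (g x * (density eps x * s.[x]))) =
  \int[mu]_(x in D) (g x * (density eps x * (Mop eps ('X * s)).[x])).
Proof.
move=> he mg gfin hD v0 cv cL; have /andP[e0 _] := he.
set q := Mop eps ('X * s).
have [C1 C10 hC1] := poly_bounded01 s.
have [C2 C20 hC2] := poly_bounded01 q.
have gi (p : {poly R}) : mu.-integrable D (EFin \o (fun x => g x * (density eps x * p.[x]))).
  have [C C0 hC] := poly_bounded01 p.
  have gf : wsqr_int eps g \is a fin_num.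
    rewrite ge0_fin_numE// integral_ge0// => x; rewrite /= in_itv /= => /andP[/ltW x0 _].
    by rewrite lee_fin mulr_ge0 ?exprn_even_ge0 ?weight_ge0.
  have := wsqr_int_bound (s := 1) 0 he mg (B := fine (wsqr_int eps g)).
  rewrite fineK// => /(_ (lexx _) ltr01) [hi _].
  have := integrable_mul_continuous hi (@continuous_horner _ p).
  by apply: eq_integrable => // x _ /=; rewrite expr0 mulr1 mulrA.
apply/eqP; rewrite -subr_eq0 -normr_le0; apply/ler_addgt0Pl => e he0; rewrite addr0.
(* Chosen so that the two errors, at most [9 C1 / t] and [9 C2 / t], add up to at most [e]. *)
pose t := (C1 + C2) * 9 / e.
have t0 : 0 < t by rewrite divr_gt0// mulr_gt0// addr_gt0.
have tp : 0 < t ^- 2 by rewrite invr_gt0 exprn_gt0.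
near \oo => k.
have [Ds hDs] := hD k; have [d0 dc _] := hDs.
have vE : {in D, v k =1 Ds 0%N}.
  by move=> x; rewrite inE /= !in_itv /= => /andP[x0 x1]; rewrite d0// in_itv /= !ltW.
have LE : {in D, realL0 eps (v k) =1 L0_of eps Ds}.
  by move=> x; rewrite inE /= => x01; exact: realL0E.
have Lc := @L0_of_within R eps Ds dc.
have mv : measurable_fun D (v k) by apply: measurable_smooth01; exists Ds.
have mL : measurable_fun D (realL0 eps (v k)) by apply: measurable_realL0 => //; exists Ds.
have wi (f f' : R -> R) (p : {poly R}) : {within `[0, 1], continuous f'} -> {in D, f =1 f'} ->
    mu.-integrable D (EFin \o (fun x => f x * (density eps x * p.[x]))).
  move=> hc hf; apply: (@within_integrable _ _ (fun x => f' x * (density eps x * p.[x]))).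
    by apply: withinM => //; apply: withinM; [exact: density_within|exact: horner_within].
  by move=> x Dx; rewrite hf.
have cvk : (wsqr_int eps (fun x => (v k x - g x)%R) <= (t ^- 2)%:E)%E by near: k; exact: cv.
have cLk : (wsqr_int eps (fun x => (realL0 eps (v k) x - l * g x)%R) <= (t ^- 2)%:E)%E.
  by near: k; exact: cL.
have [Vi Vb] := wsqr_int_poly_bound (h := fun x => v k x - g x) he
    (measurable_funB mv mg) hC2 t0 cvk.
have [Li Lb] := wsqr_int_poly_bound (h := fun x => realL0 eps (v k) x - l * g x) he
    (measurable_funB mL (measurable_funM (measurable_cst _) mg)) hC1 t0 cLk.
have E1 : \int[mu]_(x in D) ((v k x - g x) * (density eps x * q.[x])) =
    \int[mu]_(x in D) (v k x * (density eps x * q.[x])) -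
    \int[mu]_(x in D) (g x * (density eps x * q.[x])).
  rewrite -RintegralB//; last exact: wi (dc 0%N) vE.
  by apply: eq_Rintegral => x _; rewrite mulrBl.
have E2 : \int[mu]_(x in D) ((realL0 eps (v k) x - l * g x) * (density eps x * s.[x])) =
    \int[mu]_(x in D) (realL0 eps (v k) x * (density eps x * s.[x])) -
    l * \int[mu]_(x in D) (g x * (density eps x * s.[x])).
  rewrite -RintegralZl// -RintegralB//; last 2 first.
  - exact: wi Lc LE.
  - by apply: (integrableZl _ l (gi s)).
  by apply: eq_Rintegral => x _ /=; ring.
have E3 := realL0_symm s he hDs (v0 k).
move: Vb Lb; rewrite E1 E2 E3 -/q.
set I1 := Rintegral _ _ _; set I2 := Rintegral _ _ _; set I3 := Rintegral _ _ _ => b1 b2.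
have -> : e = C1 * 9 / t + C2 * 9 / t.
  by rewrite /t; field; rewrite !gt_eqF// addr_gt0.
rewrite -normrN (_ : - _ = (I1 - l * I3) - (I1 - I2)); last by ring.
by apply: le_trans (ler_normB _ _) _; exact: lerD.
Unshelve. all: by end_near. Qed.

Lemma Mop_monomial eps i x : 0 < eps -> (Mop eps ('X * 'X^i)).[x] =
  i.+1%:R * x ^+ i +
  eps / 2 * i.+1%:R * (i.+2%:R * x ^+ i.+1 - i%:R * x ^+ i.-1).
Proof.
move=> e0; rewrite MopE -exprS derivXn derivMn derivXn /=.
rewrite !hornerMn !hornerXn -!mulrnA -[x ^+ i *+ _]mulr_natl -[x ^+ i.-1 *+ _]mulr_natl natrM.
(* At [i = 0] the truncated [i.-1] is harmless, its factor [i] being [0]. *)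
have h2 : i%:R * x ^+ i.-1 * x = i%:R * x ^+ i.
  by case: i => [|i]; rewrite ?mul0r// -mulrA -exprSr.
rewrite (exprS x i) -[i.+2%:R]natr1; move: h2.
rewrite -[i.+1%:R]natr1; set y := x ^+ i.-1; set z := x ^+ i; set j : R := i%:R => h2.
rewrite (_ : (1 - x ^+ 2) * (j * (j + 1) * y) = (j + 1) * (j * y - x * (j * y * x))); last by ring.
by rewrite h2; field; rewrite gt_eqF.
Qed.

Lemma eigen_rsol_cvg0 eps l g (v : nat -> R -> R) : 0 < eps <= 4^-1 ->
  measurable_fun D g -> (wsqr_int eps g < +oo)%E -> wsqr_int eps g != 0%E ->
  (forall k, exists Ds, derivatives01 (v k) Ds) -> (forall k, v k 0 = 0) ->
  (forall e, 0 < e -> \forall k \near \oo,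
     (wsqr_int eps (fun x => (v k x - g x)%R) <= e%:E)%E) ->
  (forall e, 0 < e -> \forall k \near \oo,
     (wsqr_int eps (fun x => (realL0 eps (v k) x - l * g x)%R) <= e%:E)%E) ->
  rsol (rcoef eps l) @ \oo --> 0.
Proof.
move=> he mg gfin gn0 hD v0 cv cL; have /andP[e0 _] := he.
have gf : wsqr_int eps g \is a fin_num.
  rewrite ge0_fin_numE// integral_ge0// => x; rewrite /= in_itv /= => /andP[/ltW x0 _].
  by rewrite lee_fin mulr_ge0 ?exprn_even_ge0 ?weight_ge0.
pose B := fine (wsqr_int eps g).
have gB : (wsqr_int eps g <= B%:E)%E by rewrite fineK.
pose M i := \int[mu]_(x in D) (g x * (density eps x * x ^+ i)).
have gi i : mu.-integrable D (EFin \o (fun x => g x * (density eps x * x ^+ i))).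
  by have [] := wsqr_int_bound i he mg gB ltr01.
have hM i : l * M i = i.+1%:R * M i +
    eps / 2 * i.+1%:R * (i.+2%:R * M i.+1 - i%:R * M i.-1).
  have := eigen_weak 'X^i he mg gfin hD v0 cv cL.
  rewrite (_ : \int[mu]_(x in D) (g x * (density eps x * ('X^i).[x])) = M i); last first.
    by apply: eq_Rintegral => x _; rewrite hornerXn.
  move=> ->.
  transitivity (\int[mu]_(x in D) (i.+1%:R * (g x * (density eps x * x ^+ i)) +
    (eps / 2 * i.+1%:R) * (i.+2%:R * (g x * (density eps x * x ^+ i.+1)) -
     i%:R * (g x * (density eps x * x ^+ i.-1))))).
    by apply: eq_Rintegral => x _; rewrite Mop_monomial//; ring.
  have sc c j : mu.-integrable D (EFin \o (fun x => c * (g x * (density eps x * x ^+ j)))).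
    exact: (integrableZl _ c (gi j)).
  have sB : mu.-integrable D (EFin \o (fun x => i.+2%:R * (g x * (density eps x * x ^+ i.+1)) -
     i%:R * (g x * (density eps x * x ^+ i.-1)))).
    exact: (integrableB _ (sc _ _) (sc _ _)).
  rewrite RintegralD//; last exact: (integrableZl _ _ sB).
  by rewrite !RintegralZl// RintegralB// !RintegralZl.
(* As [density = x * weight], the moment [M k.-1] is the weighted pairing of [g] with [x^k]; at
   [k = 0] the factor [k] makes [d] vanish. *)
pose d k := (-1) ^+ k * k%:R * M k.-1.
have drec : recurrence (rcoef eps l) d.
  move=> k; rewrite /d /rcoef /=; have := hM k; rewrite !exprS.
  have k1 : k.+1%:R != 0 :> R by rewrite pnatr_eq0.
  set c := k.+1%:R in k1 *; clearbody c; move=> h.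
  have hk : k.+2%:R * M k.+1 = k%:R * M k.-1 + 2 / eps / c * (l * M k - c * M k).
    by rewrite h; field; rewrite k1 gt_eqF.
  rewrite -(mulrA _ k.+2%:R) hk; field; by rewrite k1 gt_eqF.
have d0 : d 0%N = 0 by rewrite /d mulr0 mul0r.
have dE := recurrence_rsol drec d0.
(* Otherwise every moment of [g * density] is [0], hence [g] is [0] almost everywhere. *)
have d1 : d 1%N != 0.
  apply: contra_neq gn0 => d10.
  have M0 i : M i = 0.
    have := dE i.+1; rewrite d10 mul0r => /eqP.
    by rewrite /d !mulf_eq0 signr_eq0 pnatr_eq0 /= => /eqP.
  have Fi : mu.-integrable D (EFin \o (fun x => g x * density eps x)).
    by apply: eq_integrable (gi 0%N) => // x _ /=; rewrite expr0 mulr1.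
  have := moments_ae_eq0 Fi => /(_ _)/wrap[].
    move=> i; rewrite -[RHS](M0 i); apply: eq_Rintegral => x _; by rewrite mulrA.
  move=> ae0; rewrite /wsqr_int -[RHS](integral0 mu D).
  apply: ae_eq_integral => //.
    apply/measurable_EFinP/measurable_funM; last exact: measurable_weight.
    exact: measurable_funX.
  apply: filterS ae0; first exact: (ae_filter_ringOfSetsType mu).
  move=> x + Dx => /(_ Dx); move: Dx; rewrite /= in_itv /= => /andP[x0 x1].
  move=> /eqP; rewrite mulf_eq0 [density _ _ == 0]gt_eqF ?orbF; last first.
    by rewrite density_gt0// x1 ltW.
  by move=> /eqP ->; rewrite expr0n mul0r.
have Mb i : `|M i| <= (B + 16) / 2 / i.+1%:R ^+ 2.
  (* The choice [s = (i + 1)^-2] gives both terms of the bound the order [(i + 1)^-2]. *)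
  have s0 : 0 < i.+1%:R ^- 2 :> R by rewrite invr_gt0 exprn_gt0 ?ltr0n.
  have [_ hle] := wsqr_int_bound i he mg gB s0.
  apply: le_trans (le_normr_Rintegral _ (gi i)) _ => //.
  apply: le_trans hle _; rewrite le_eqVlt; apply/orP; left; apply/eqP.
  by field; rewrite nat1r pnatr_eq0.
have dc : d @ \oo --> 0.
  rewrite -(cvg_shiftS d); apply/norm_cvg0P.
  apply: (@squeeze_cvgr _ _ _ _ (fun=> 0) (fun i => (B + 16) / 2 * i.+1%:R^-1)).
  - near=> i; rewrite normr_ge0 /= /d /= !normrM normrX normrN1 expr1n mul1r normr_nat.
    apply: le_trans (_ : i.+1%:R * ((B + 16) / 2 / i.+1%:R ^+ 2) <= _).
      by rewrite ler_wpM2l.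
    by rewrite le_eqVlt; apply/orP; left; apply/eqP; field; rewrite nat1r pnatr_eq0.
  - exact: cvg_cst.
  have h := cvgMl_tmp (a := (B + 16) / 2) (@cvg_harmonic R); rewrite mulr0 in h; exact: h.
have -> : rsol (rcoef eps l) = (fun k => (d 1%N)^-1 * d k).
  by apply/funext => k; rewrite (dE k) mulKf.
have h := cvgMl_tmp (a := (d 1%N)^-1) dc; rewrite mulr0 in h; exact: h.
Unshelve. all: by end_near. Qed.

End necessary.

(** * Reduction to real and imaginary parts *)

Section complex_valued.
Local Open Scope complex_scope.
Context {R : realType}.
Implicit Types (eps x l : R) (f h u : R -> R[i]) (X : nat -> \bar R).

Notation mu := (@lebesgue_measure R).
Notation D := (`]0, 1[%classic : set R).

Lemma cvg0_poweR12 X : (forall k, 0 <= X k)%E ->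
  (X k `^ 2^-1 @[k --> \oo] --> 0)%E ->
  forall e : R, 0 < e -> \forall k \near \oo, (X k <= e%:E)%E.
Proof.
move=> X0 /fine_cvgP[Xf /cvgr0Pnorm_lt Xc] e e0.
have se : 0 < Num.sqrt e by rewrite sqrtr_gt0.
near=> k.
have Xkf : (X k `^ 2^-1)%E \is a fin_num by near: k.
have : `|fine (X k `^ 2^-1)%E| < Num.sqrt e by near: k; exact: Xc.
have Xk : X k \is a fin_num.
  rewrite ge0_fin_numE// ltey; apply/eqP => h; move: Xkf.
  by rewrite h poweRyr// gt_eqF// invr_gt0.
rewrite fine_poweR powR12_sqrt ?fine_ge0// ger0_norm ?sqrtr_ge0// => h.
rewrite -(fineK Xk) lee_fin ltW//.
by move: h; rewrite ltr_sqrt.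
Unshelve. all: by end_near. Qed.

Lemma poweR12_cvg0 X (c : nat -> R) : (forall k, 0 <= X k <= (c k)%:E)%E ->
  c @ \oo --> 0 -> (X k `^ 2^-1 @[k --> \oo] --> 0)%E.
Proof.
move=> hX cc; have Xk k : X k \is a fin_num.
  have /andP[h0 h1] := hX k; rewrite ge0_fin_numE//.
  exact: le_lt_trans h1 (ltry _).
apply/fine_cvgP; split; first by near=> k; rewrite fin_num_poweR.
have -> : fine \o (fun k => (X k `^ 2^-1)%E) = Num.sqrt \o (fine \o X).
  apply/funext => k /=; rewrite fine_poweR powR12_sqrt// fine_ge0//.
  by have /andP[] := hX k.
have s0 : Num.sqrt y @[y --> (0 : R)] --> (0 : R).
  by have := @sqrt_continuous R 0; rewrite /continuous_at sqrtr0.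
apply: cvg_comp s0.
apply: (@squeeze_cvgr _ _ _ _ (fun=> 0) c) => //; last exact: cvg_cst.
near=> k; have /andP[h0 h1] := hX k; rewrite fine_ge0//=.
by rewrite -lee_fin fineK.
Unshelve. all: by end_near. Qed.

Definition sqint eps h := (\int[mu]_(x in D) (normc (h x) ^+ 2 * (2 * weight eps x))%:E)%E.

Lemma sqint_ge0 eps h : (0 <= sqint eps h)%E.
Proof.
apply: integral_ge0 => x /=; rewrite in_itv /= => /andP[/ltW x0 _].
by rewrite lee_fin mulr_ge0 ?exprn_even_ge0// mulr_ge0 ?weight_ge0.
Qed.

Lemma normc_sqr (z : R[i]) : normc z ^+ 2 = complex.Re z ^+ 2 + complex.Im z ^+ 2.
Proof. by case: z => a b; rewrite /normc /= sqr_sqrtr// addr_ge0 ?sqr_ge0. Qed.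

Definition cmeasurable h := measurable_fun D (fun x => complex.Re (h x)) /\
  measurable_fun D (fun x => complex.Im (h x)).

Lemma measurable_normc_sqr h : cmeasurable h -> measurable_fun D (fun x => normc (h x) ^+ 2).
Proof.
move=> [mr mi]; have -> : (fun x => normc (h x) ^+ 2) =
    (fun x => complex.Re (h x) ^+ 2 + complex.Im (h x) ^+ 2).
  by apply/funext => x; exact: normc_sqr.
by apply: measurable_funD; apply: measurable_funX.
Qed.

Lemma measurable_sqint eps h : cmeasurable h ->
  measurable_fun D (fun x => normc (h x) ^+ 2 * (2 * weight eps x)).
Proof.
move=> mh; apply: measurable_funM; first exact: measurable_normc_sqr.
by apply: measurable_funM => //; exact: measurable_weight.
Qed.

Lemma wsqr_int_le_sqint eps h (g : R -> R) : cmeasurable h -> measurable_fun D g ->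
  (forall x, g x ^+ 2 <= normc (h x) ^+ 2) -> (wsqr_int eps g <= sqint eps h)%E.
Proof.
move=> mh mg gh; apply: ge0_le_integral => //.
- move=> x /=; rewrite in_itv /= => /andP[/ltW x0 _].
  by rewrite lee_fin mulr_ge0 ?exprn_even_ge0 ?weight_ge0.
- apply/measurable_EFinP/measurable_funM; last exact: measurable_weight.
  exact: measurable_funX.
- by apply/measurable_EFinP; exact: measurable_sqint.
move=> x /=; rewrite in_itv /= => /andP[/ltW x0 _].
have w0 := weight_ge0 eps x0.
by rewrite lee_fin; apply: ler_pM; rewrite ?sqr_ge0//; lra.
Qed.

Lemma Re_L0 eps u x : complex.Re (L0 eps u x) = realL0 eps (fun y => complex.Re (u y)) x.
Proof.
rewrite /L0 /realL0 /cderive /=.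
under eq_fun do rewrite mul0r subr0.
by ring.
Qed.

Lemma Im_L0 eps u x : complex.Im (L0 eps u x) = realL0 eps (fun y => complex.Im (u y)) x.
Proof.
rewrite /L0 /realL0 {1}/cderive.
have -> : (fun y => complex.Im ((pcoef eps y)%:C * cderive u y)) =
    (fun y => pcoef eps y * derive1 (fun y0 => complex.Im (u y0)) y).
  by apply/funext => y; rewrite /cderive /= mul0r addr0.
by rewrite /=; ring.
Qed.

(** The operator has real coefficients and [l] is real, so both components of an eigenfunction
    satisfy the real hypotheses, and at least one of them is not null. *)
Lemma eigenvalue_rsol_cvg0 eps l : 0 < eps <= 4^-1 -> L_eigenvalue eps l%:C ->
  rsol (rcoef eps l) @ \oo --> 0.
Proof.
move=> he [f [[mfr mfi ffin] _ [u [u0 uf Luf]]] fn0]; have /andP[e0 _] := he.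
have mf : cmeasurable f by [].
have ReB (a b : R[i]) : complex.Re (a - b) = complex.Re a - complex.Re b.
  by case: a b => [? ?] [].
have ImB (a b : R[i]) : complex.Im (a - b) = complex.Im a - complex.Im b.
  by case: a b => [? ?] [].
have msub h1 h2 : cmeasurable h1 -> cmeasurable h2 -> cmeasurable (fun x => h1 x - h2 x).
  move=> [a b] [a' b']; split.
    rewrite (_ : (fun x => _) = (fun x => complex.Re (h1 x) - complex.Re (h2 x))).
      exact: measurable_funB.
    by apply/funext => x; exact: ReB.
  rewrite (_ : (fun x => _) = (fun x => complex.Im (h1 x) - complex.Im (h2 x))).
    exact: measurable_funB.
  by apply/funext => x; exact: ImB.
have Rel z : complex.Re (l%:C * z) = l * complex.Re z by case: z => a b /=; ring.
have Iml z : complex.Im (l%:C * z) = l * complex.Im z by case: z => a b /=; ring.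
have mlf : cmeasurable (fun x => l%:C * f x).
  split.
    rewrite (_ : (fun x => _) = (fun x => l * complex.Re (f x))).
      exact: measurable_funM.
    by apply/funext => x; exact: Rel.
  rewrite (_ : (fun x => _) = (fun x => l * complex.Im (f x))).
    exact: measurable_funM.
  by apply/funext => x; exact: Iml.
have mu_ k : cmeasurable (u k).
  by have [[sr si] _] := u0 k; split; exact: measurable_smooth01.
have mLu k : cmeasurable (L0 eps (u k)).
  have [[sr si] _] := u0 k; split.
    rewrite (_ : (fun x => _) = realL0 eps (fun y => complex.Re (u k y))).
      exact: measurable_realL0.
    by apply/funext => x; exact: Re_L0.
  rewrite (_ : (fun x => _) = realL0 eps (fun y => complex.Im (u k y))).
    exact: measurable_realL0.
  by apply/funext => x; exact: Im_L0.
have c1 := cvg0_poweR12 (fun k => sqint_ge0 eps _) uf.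
have c2 := cvg0_poweR12 (fun k => sqint_ge0 eps _) Luf.
have ffin' : (sqint eps f < +oo)%E by apply: lty_poweRy ffin; rewrite invr_eq0.
have sqr_le_norm (z : R[i]) : complex.Re z ^+ 2 <= normc z ^+ 2 /\
    complex.Im z ^+ 2 <= normc z ^+ 2.
  by rewrite normc_sqr lerDl lerDr !sqr_ge0.
have component (c : R[i] -> R) :
    (forall a b, c (a - b) = c a - c b) -> (forall a, c (l%:C * a) = l * c a) ->
    (forall z, c z ^+ 2 <= normc z ^+ 2) -> (c 0 = 0) ->
    (forall h, cmeasurable h -> measurable_fun D (fun x => c (h x))) ->
    (forall k, smooth01 (fun x => c (u k x))) ->
    (forall k x, c (L0 eps (u k) x) = realL0 eps (fun y => c (u k y)) x) ->
    wsqr_int eps (fun x => c (f x)) != 0%E -> rsol (rcoef eps l) @ \oo --> 0.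
  move=> cB cl cn c0 cm cs cL cf0.
  apply: (@eigen_rsol_cvg0 R eps l (fun x => c (f x)) (fun k x => c (u k x)) he) => //.
  - exact: cm.
  - by apply: le_lt_trans ffin'; apply: wsqr_int_le_sqint => //; exact: cm.
  - by move=> k; have [_ ->] := u0 k.
  - move=> e ep; near=> k.
    apply: (@le_trans _ _ (sqint eps (fun x => u k x - f x))); last by near: k; exact: c1.
    apply: wsqr_int_le_sqint; first exact: msub.
      by apply: measurable_funB; exact: cm.
    by move=> x; rewrite -cB.
  - move=> e ep; near=> k.
    apply: (@le_trans _ _ (sqint eps (fun x => L0 eps (u k) x - l%:C * f x))); last first.
      by near: k; exact: c2.
    have E x : realL0 eps (fun y => c (u k y)) x - l * c (f x) =
        c (L0 eps (u k) x - l%:C * f x) by rewrite cB cL cl.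
    apply: wsqr_int_le_sqint; first exact: msub.
      rewrite (_ : (fun x => _) = (fun x => c (L0 eps (u k) x - l%:C * f x))).
        by apply: cm; exact: msub.
      by apply/funext.
    by move=> x; rewrite E.
have [Re0|Re0] := eqVneq (wsqr_int eps (fun x => complex.Re (f x))) 0%E; last first.
  apply: (component (@complex.Re R) _ _ _ _ _ _ _ Re0) => //.
  - by move=> z; have [] := sqr_le_norm z.
  - by move=> h [].
  - by move=> k; have [[]] := u0 k.
  - by move=> k x; exact: Re_L0.
have [Im0|Im0] := eqVneq (wsqr_int eps (fun x => complex.Im (f x))) 0%E; last first.
  apply: (component (@complex.Im R) _ _ _ _ _ _ _ Im0) => //.
  - by move=> z; have [] := sqr_le_norm z.
  - by move=> h [].
  - by move=> k; have [[]] := u0 k.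
  - by move=> k x; exact: Im_L0.
have : sqint eps f = 0%E.
  have w2 (g : R -> R) : measurable_fun D g -> measurable_fun D (fun x => g x ^+ 2 * weight eps x).
    by move=> mg; apply: measurable_funM; [exact: measurable_funX|exact: measurable_weight].
  have p2 (g : R -> R) x : D x -> (0 <= (g x ^+ 2 * weight eps x)%:E)%E.
    rewrite /= in_itv /= => /andP[/ltW x0 _].
    by rewrite lee_fin mulr_ge0 ?exprn_even_ge0 ?weight_ge0.
  transitivity (2%:E * (wsqr_int eps (fun x => complex.Re (f x)) +
     wsqr_int eps (fun x => complex.Im (f x))))%E; last by rewrite Re0 Im0 adde0 mule0.
  rewrite /wsqr_int -ge0_integralD//; last 4 first.
  - by move=> x Dx; apply: (p2 (fun x => complex.Re (f x))).
  - by apply/measurable_EFinP; exact: w2.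
  - by move=> x Dx; apply: (p2 (fun x => complex.Im (f x))).
  - by apply/measurable_EFinP; exact: w2.
  rewrite -ge0_integralZl//; last 2 first.
  - by apply/measurable_EFinP; apply: measurable_funD; exact: w2.
  - move=> x Dx; apply: adde_ge0.
      exact: (p2 (fun x => complex.Re (f x))).
    exact: (p2 (fun x => complex.Im (f x))).
  by apply: eq_integral => x _; rewrite normc_sqr -EFinD -EFinM; congr EFin; ring.
move=> f0; move: fn0; rewrite /L2norm -/(sqint eps f) f0 poweR0r ?eqxx.
Unshelve. all: by end_near. Qed.

End complex_valued.

(** * Bounded summable solutions give eigenvalues *)

Section sufficient.
Local Open Scope complex_scope.
Context {R : realType}.
Implicit Types (eps x l : R) (a b : nat -> R) (p q : {poly R}) (k n m N : nat).

Notation mu := (@lebesgue_measure R).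
Notation D := (`]0, 1[%classic : set R).

Definition series_trunc a N : {poly R} := \sum_(0 <= k < N) a k *: 'X^k.

Definition psum a x : R := limn (fun N => (series_trunc a N).[x]).

Lemma horner_trunc a N x : (series_trunc a N).[x] = \sum_(0 <= k < N) a k * x ^+ k.
Proof.
by rewrite /series_trunc horner_sum; apply: eq_bigr => k _; rewrite hornerZ hornerXn.
Qed.

(** [t N] is the tail of the sum of the [|a k|], and on [[0, 1]] the powers from [N] on are at most
    [x^N]. This factor later absorbs the singularity of the weight. *)
Lemma psum_approx a S : (forall N, \sum_(0 <= k < N) `|a k| <= S) ->
  exists2 t : nat -> R, t @ \oo --> 0 &
  (forall N, 0 <= t N) /\
  forall N x, 0 <= x <= 1 ->
    (series_trunc a n).[x] @[n --> \oo] --> psum a x /\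
    `|(series_trunc a N).[x] - psum a x| <= t N * x ^+ N.
Proof.
move=> hS; pose A N := \sum_(0 <= k < N) `|a k|.
have A_mono : nondecreasing_seq A.
  move=> m n mn; rewrite /A [leRHS](@big_cat_nat _ _ _ m)//=.
  by rewrite lerDl sumr_ge0.
have A_ub : has_ubound (range A) by exists S => _ [N _ <-]; exact: hS.
have A_cvg := nondecreasing_is_cvgn A_mono A_ub.
pose t N := limn A - A N.
have t0 N : 0 <= t N by rewrite subr_ge0 nondecreasing_cvgn_le.
exists t.
  rewrite -(subrr (limn A)); apply: cvgB; [exact: cvg_cst|exact: A_cvg].
split=> // N x /andP[x0 x1].
have tailE m n : (m <= n)%N ->
    `|(series_trunc a n).[x] - (series_trunc a m).[x]| <= (A n - A m) * x ^+ m.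
  move=> mn; rewrite !horner_trunc /A !(@big_cat_nat _ _ _ m 0 n)//=.
  rewrite addrAC subrr add0r [X in _ <= X * _]addrAC subrr add0r mulr_suml.
  apply: le_trans (ler_norm_sum _ _ _) _.
  apply: ler_sum_nat => k /andP[mk _].
  by rewrite normrM ler_wpM2l// ger0_norm ?exprn_ge0// ler_wiXn2l.
have pc : cvgn (fun n => (series_trunc a n).[x]).
  rewrite (_ : (fun n => _) = series (fun k => a k * x ^+ k)); last first.
    by apply/funext => n; rewrite horner_trunc.
  apply: normed_cvg; apply: nondecreasing_is_cvgn.
    move=> m n mn; rewrite /series /= [leRHS](@big_cat_nat _ _ _ m)//=.
    by rewrite lerDl sumr_ge0.
  exists S => _ [n _ <-]; apply: le_trans (hS n); rewrite /series /=.
  apply: ler_sum_nat => k _; rewrite normrM ler_piMr// ger0_norm ?exprn_ge0//.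
  exact: exprn_ile1.
split => //.
have h1 : `|(series_trunc a N).[x] - (series_trunc a n).[x]| @[n --> \oo] -->
    `|(series_trunc a N).[x] - psum a x|.
  by apply: cvg_norm; apply: cvgB; [exact: cvg_cst|exact: pc].
apply: (ler_cvg_to h1 (cvg_cst (t N * x ^+ N))).
exists N => // n /= Nn; rewrite distrC (le_trans (tailE _ _ Nn))//.
by rewrite ler_wpM2r ?exprn_ge0// lerD2r nondecreasing_cvgn_le.
Qed.

Lemma truncS a N : series_trunc a N.+1 = series_trunc a N + a N *: 'X^N.
Proof. by rewrite /series_trunc big_nat_recr. Qed.

Lemma MopDZ eps p q c x : (Mop eps (p + c *: q)).[x] = (Mop eps p).[x] + c * (Mop eps q).[x].
Proof. by rewrite !MopE !(derivD, derivZ) !(hornerD, hornerZ); ring. Qed.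

(* Truncating the eigenfunction series leaves only the two boundary terms of the
   tridiagonal matrix of the operator. *)
Lemma Mop_trunc eps l n x : 0 < eps ->
  let b := rsol (rcoef eps l) in let U := series_trunc (fun k => b k / k%:R) n.+1 in
  x * (Mop eps U).[x] = l * U.[x] +
    eps / 2 * (n%:R * b n.+1 * x ^+ n + n.+1%:R * b n * x ^+ n.+1).
Proof.
move=> e0 b; elim: n => [|n IH]; cbv zeta.
  rewrite truncS /series_trunc big_geq// MopE /b /= !mul0r scale0r addr0 !deriv0 !horner0; ring.
rewrite truncS MopDZ mulrDr IH (exprS 'X n) Mop_monomial// hornerD hornerZ hornerM hornerX hornerXn.
set U := (series_trunc _ _).[x].
rewrite [b n.+2](rsol_recurrence (rcoef eps l)) -/b -/(b n) -/(b n.+1).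
rewrite /rcoef; have c0 : n.+1%:R != 0 :> R by rewrite pnatr_eq0.
have h2 : n%:R * x ^+ n.-1 * x = n%:R * x ^+ n.
  by case: (n) => [|i]; rewrite ?mul0r// -mulrA -exprSr.
rewrite -[n.+2%:R]natr1; set c := n.+1%:R in c0 *; clearbody c.
rewrite (exprS x n.+1) (exprS x n).
rewrite (_ : x * (b n.+1 / c * _) = b n.+1 / c * (c * (x * x ^+ n) +
  eps / 2 * c * ((c + 1) * (x * (x * x ^+ n)) -
   (n%:R * x ^+ n.-1 * x)))); last by ring.
rewrite h2 -/b; field; by rewrite c0 gt_eqF.
Qed.

Lemma derivatives01_poly p : derivatives01 (horner p) (fun k => horner p^`(k)).
Proof.
split=> [x _|k|k x _]; first by rewrite derivn0.
- exact: horner_within.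
- by rewrite derivnS; exact: is_derive_poly.
Qed.

Lemma realL0_poly eps p x : 0 < eps -> x \in `]0, 1[ ->
  realL0 eps (horner p) x = x * (Mop eps p).[x].
Proof.
move=> e0 x01; rewrite (realL0E e0 (derivatives01_poly p))// MopE.
by rewrite /L0_of !derivnS derivn0; ring.
Qed.

Lemma sqint_real_le eps (g : R -> R) c : measurable_fun D g ->
  (forall x, D x -> g x ^+ 2 * (2 * weight eps x) <= c) ->
  (sqint eps (fun x => (g x)%:C) <= c%:E)%E.
Proof.
move=> mg hg; have mgC : cmeasurable (fun x => (g x)%:C) by split.
have mD : mu D = 1%E by rewrite lebesgue_measure_itv /= lte_fin ltr01 oppr0 adde0.
have -> : c%:E = (\int[mu]_(x in D) (cst c%:E) x)%E.
  by rewrite integral_cst// [X in (_ * X)%E]mD mule1.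
apply: ge0_le_integral => //.
- move=> x /=; rewrite in_itv /= => /andP[/ltW x0 _].
  by rewrite lee_fin mulr_ge0 ?exprn_even_ge0// mulr_ge0 ?weight_ge0.
- by apply/measurable_EFinP; exact: measurable_sqint.
by move=> x Dx; rewrite lee_fin normc_sqr /= expr0n addr0 hg.
Qed.

Lemma L0_real eps p x : L0 eps (fun y => (p.[y])%:C) x = (realL0 eps (horner p) x)%:C.
Proof.
have := Re_L0 eps (fun y => (p.[y])%:C) x; have := Im_L0 eps (fun y => (p.[y])%:C) x.
case: (L0 _ _ _) => re im; rewrite [complex.Im _]/= [complex.Re (_ +i* _)]/= => -> ->.
congr (_ +i* _); rewrite /realL0 /= (_ : (fun y => _) = cst 0) ?derive1_cst ?mulr0//.
by apply/funext => y; rewrite derive1_cst mulr0.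
Qed.

Lemma eigenvalue_of_summable eps l (C S : R) : 0 < eps <= 4^-1 ->
  (forall k, `|rsol (rcoef eps l) k| <= C) ->
  (forall N, \sum_(k < N) `|rsol (rcoef eps l) k| / k%:R <= S) ->
  L_eigenvalue eps l%:C.
Proof.
move=> he; set b := rsol _ => hC hS; have /andP[e0 e4] := he.
pose a k := b k / k%:R.
have hA N : \sum_(0 <= k < N) `|a k| <= S.
  rewrite big_mkord; apply: le_trans (hS N); apply: ler_sum => k _.
  by rewrite normrM normfV normr_nat.
have [t t_cvg [t0 ht]] := psum_approx hA.
pose U n := series_trunc a n; pose F := psum a.
have D01 x : D x -> [/\ 0 < x, x < 1 & 0 <= x <= 1].
  by rewrite /= in_itv /= => /andP[x0 x1]; split; rewrite ?ltW.
have UF n x : D x -> `|(U n).[x] - F x| <= t n * x ^+ n.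
  by move=> /D01[_ _ /(ht n)[]].
have mU n : measurable_fun D (horner (U n)).
  exact: continuous_measurable_D (@continuous_horner _ _).
have mF : measurable_fun D F.
  by apply: (measurable_fun_cvg mU) => x /D01[_ _ /(ht 0%N)[]].
have wx x : D x -> x ^+ 2 * weight eps x <= 1.
  move=> Dx; have [x0 x1 x01] := D01 x Dx.
  rewrite weightE (_ : _ * _ = x * density eps x); last by field; rewrite gt_eqF.
  rewrite mulr_ile1 ?density_ge0 ?(ltW x0) ?(ltW x1)//.
  by apply: le_trans (density_le he x01) _; rewrite exprn_ile1//; lra.
have w0 x : D x -> 0 <= weight eps x by move=> /D01[/ltW x0 _ _]; exact: weight_ge0.
(* For [n >= 1] the error carries a factor [x], whose square tames the weight. *)
have UFsqr n x : (0 < n)%N -> D x -> ((U n).[x] - F x) ^+ 2 * (2 * weight eps x) <= 2 * t n ^+ 2.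
  move=> n0 Dx; have [x0 x1 x01] := D01 x Dx.
  have h : `|(U n).[x] - F x| <= t n * x.
    apply: le_trans (UF n x Dx) _; rewrite ler_wpM2l//.
    by rewrite -[leRHS]expr1 ler_wiXn2l// ltW.
  have h2 : ((U n).[x] - F x) ^+ 2 <= (t n * x) ^+ 2.
    by rewrite -real_normK ?num_real// lerXn2r ?nnegrE ?mulr_ge0// ltW.
  apply: le_trans (_ : (t n * x) ^+ 2 * (2 * weight eps x) <= _).
    by rewrite ler_wpM2r// mulr_ge0// w0.
  rewrite (_ : _ * _ = 2 * t n ^+ 2 * (x ^+ 2 * weight eps x)); last by ring.
  by rewrite ler_piMr ?mulr_ge0 ?exprn_ge0// wx.
have C0 : 0 <= C := le_trans (normr_ge0 _) (hC 0%N).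
pose f x := (F x)%:C.
have realL2 (g : R -> R) c : measurable_fun D g ->
    (forall x, D x -> g x ^+ 2 * (2 * weight eps x) <= c) -> inL2 eps (fun x => (g x)%:C).
  move=> mg hg; split=> //; rewrite /L2norm -/(sqint eps (fun x => (g x)%:C)).
  by apply: poweR_lty; apply: le_lt_trans (ltry c); exact: sqint_real_le.
(* As [a 0 = 0], the truncation [U 1] is zero, so [UFsqr] at [n = 1] bounds [F] itself. *)
have Fsqr x : D x -> F x ^+ 2 * (2 * weight eps x) <= 2 * t 1%N ^+ 2.
  move=> Dx; have := UFsqr 1%N x isT Dx.
  by rewrite /U /series_trunc big_nat1 /a mul0r scale0r horner0 sub0r sqrrN.
have fL2 : inL2 eps f by exact: realL2 mF Fsqr.
have lfE : (fun x => l%:C * f x) = (fun x => (l * F x)%:C).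
  by apply/funext => x; rewrite /f -rmorphM.
have lfL2 : inL2 eps (fun x => l%:C * f x).
  rewrite lfE; apply: (realL2 _ (l ^+ 2 * (2 * t 1%N ^+ 2))).
    exact: measurable_funM.
  by move=> x Dx; rewrite exprMn -mulrA ler_wpM2l ?sqr_ge0// Fsqr.
(* With the shift by [2], the lowest boundary power is [x^(k+1)], whose square [expr_weight_le]
   bounds at index [k]. *)
pose u k x : R[i] := ((U k.+2).[x])%:C.
have u_cvg : L2norm eps (fun x => u k x - f x) @[k --> \oo] --> 0%E.
  pose X k := sqint eps (fun x => u k x - f x).
  apply: (@poweR12_cvg0 _ X (fun k => 2 * t k.+2 ^+ 2)).
    move=> k; rewrite sqint_ge0 /X /=.
    rewrite (_ : (fun x => _) = (fun x => ((U k.+2).[x] - F x)%:C)); last first.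
      by apply/funext => x; rewrite /u /f -rmorphB.
    by apply: sqint_real_le; [exact: measurable_funB|move=> x; exact: UFsqr].
  have h : 2 * t k.+2 ^+ 2 @[k --> \oo] --> (2 * 0 ^+ 2 : R).
    apply: cvgMl_tmp; apply: (@cvg_comp _ _ _ (fun k => t k.+2) (fun y => y ^+ 2)).
      by apply: (cvg_comp (fun k => k.+2) t) t_cvg; exact: cvg_addnl 2.
    exact: exprn_continuous.
  by rewrite expr0n mulr0 in h.
have Lu_cvg : L2norm eps (fun x => L0 eps (u k) x - l%:C * f x) @[k --> \oo] --> 0%E.
  pose X k := sqint eps (fun x => L0 eps (u k) x - l%:C * f x).
  (* The error is [l d + E], with [d] the truncation error and [E] the boundary terms;
     [(l d + E)^2 <= 2 l^2 d^2 + 2 E^2] gives the two summands. *)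
  apply: (@poweR12_cvg0 _ X
    (fun k => 4 * l ^+ 2 * t k.+2 ^+ 2 + 256 * C ^+ 2 * k.+1%:R^-1 ^+ 2)).
    move=> k; rewrite sqint_ge0 /X /=.
    rewrite (_ : (fun x => _) =
      (fun x => (realL0 eps (horner (U k.+2)) x - l * F x)%:C)); last first.
      by apply/funext => x; rewrite /u L0_real /f -rmorphM -rmorphB.
    apply: sqint_real_le.
      apply: measurable_funB; last exact: measurable_funM.
      apply: measurable_realL0 => //; exists (fun j => horner (U k.+2)^`(j)).
      exact: derivatives01_poly.
    move=> x Dx; have [x0 x1 x01] := D01 x Dx.
    rewrite realL0_poly// Mop_trunc// -/b -/a -/(U k.+2).
    have := UFsqr k.+2 x isT Dx; set d := (U k.+2).[x] - F x => hd.
    set E := eps / 2 * _.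
    have -> : l * (U k.+2).[x] + E - l * F x = l * d + E by rewrite /d; ring.
    have xk : 0 <= x ^+ k.+1 by rewrite exprn_ge0// ltW.
    have k1 : 1 <= k.+1%:R :> R by rewrite ler1n.
    have ax : `|x| = x by rewrite ger0_norm// ltW.
    have hE : `|E| <= C * (2 * k.+1%:R) * x ^+ k.+1.
      have h1 : `|k.+1%:R * b k.+2 * x ^+ k.+1| <= C * k.+1%:R * x ^+ k.+1.
        rewrite normrM [`|_ * b _|]normrM normr_nat normrX ax ler_wpM2r// mulrC.
        by rewrite ler_wpM2r// hC.
      have h2 : `|k.+2%:R * b k.+1 * x ^+ k.+2| <= C * (2 * k.+1%:R) * x ^+ k.+1.
        rewrite normrM [`|_ * b _|]normrM normr_nat normrX ax.
        have h3 : k.+2%:R * `|b k.+1| <= C * (2 * k.+1%:R).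
          apply: le_trans (ler_wpM2l (ler0n _ _) (hC _)) _.
          by rewrite [leLHS]mulrC ler_wpM2l// -natrM ler_nat mul2n -addnn addSn ltnS leq_addl.
        apply: ler_pM; [by rewrite mulr_ge0|by rewrite exprn_ge0// ltW|by []|].
        by rewrite exprS ler_piMl// ltW.
      rewrite /E normrM (ger0_norm (divr_ge0 (ltW e0) _))//.
      apply: le_trans (_ : eps / 2 * (C * k.+1%:R * x ^+ k.+1 +
          C * (2 * k.+1%:R) * x ^+ k.+1) <= _).
        rewrite ler_wpM2l ?divr_ge0 ?(ltW e0)//.
        by apply: le_trans (ler_normD _ _) (lerD h1 h2).
      have : 0 <= C * k.+1%:R * x ^+ k.+1 by rewrite !mulr_ge0.
      by nra.
    have hE2 : E ^+ 2 <= (C * (2 * k.+1%:R) * x ^+ k.+1) ^+ 2.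
      by rewrite -real_normK ?num_real// lerXn2r ?nnegrE// !mulr_ge0.
    have hw := expr_weight_le k he (introT andP (conj x0 x1)).
    have w0x := w0 x Dx.
    have hEw : E ^+ 2 * (2 * weight eps x) <= 128 * C ^+ 2 * k.+1%:R^-1 ^+ 2.
      apply: le_trans (_ : (C * (2 * k.+1%:R) * x ^+ k.+1) ^+ 2 * (2 * weight eps x) <= _).
        by rewrite ler_wpM2r// mulr_ge0.
      rewrite (_ : _ * _ = 8 * C ^+ 2 * k.+1%:R ^+ 2 * (x ^+ k.*2.+2 * weight eps x)); last first.
        have -> : x ^+ k.*2.+2 = (x ^+ k.+1) ^+ 2 by rewrite -exprM muln2 doubleS.
        by ring.
      apply: le_trans (_ : 8 * C ^+ 2 * k.+1%:R ^+ 2 * (16 / k.+1%:R ^+ 4) <= _).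
        by rewrite ler_wpM2l// mulr_ge0 ?exprn_ge0// mulr_ge0 ?exprn_ge0.
      by rewrite le_eqVlt; apply/orP; left; apply/eqP; field; rewrite nat1r pnatr_eq0.
    apply: le_trans (_ : 2 * l ^+ 2 * (d ^+ 2 * (2 * weight eps x)) +
        2 * (E ^+ 2 * (2 * weight eps x)) <= _).
      have : 0 <= (l * d - E) ^+ 2 * weight eps x by rewrite mulr_ge0 ?sqr_ge0.
      nra.
    have hl : 0 <= 2 * l ^+ 2 by rewrite mulr_ge0 ?sqr_ge0.
    apply: le_trans (lerD (ler_wpM2l hl hd) (ler_wpM2l (ler0n _ 2) hEw)) _.
    by rewrite le_eqVlt; apply/orP; left; apply/eqP; ring.
  have tS : t k.+2 @[k --> \oo] --> (0 : R).
    by apply: (cvg_comp (fun k => k.+2) t) t_cvg; exact: cvg_addnl 2.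
  have sq (v : nat -> R) : v @ \oo --> 0 -> v k ^+ 2 @[k --> \oo] --> (0 ^+ 2 : R).
    by move=> vc; apply: (@cvg_comp _ _ _ v (fun y => y ^+ 2)) vc _; exact: exprn_continuous.
  have h := cvgD (cvgMl_tmp (a := 4 * l ^+ 2) (sq _ tS))
    (cvgMl_tmp (a := 256 * C ^+ 2) (sq _ (@cvg_harmonic R))).
  rewrite expr0n !mulr0 addr0 in h; exact: h.
exists f.
  split=> //; exists u; split => // k; split; last first.
    rewrite /u horner_trunc big_nat_recl// expr0 mulr1 /a mul0r add0r.
    by rewrite big1 // => i _; rewrite exprS mul0r mulr0.
  split; first by exists (fun j => horner (U k.+2)^`(j)); exact: derivatives01_poly.
  exists (fun j => horner (0 : {poly R})^`(j)); have h := derivatives01_poly 0.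
  have h0 : horner (0 : {poly R}) = (fun=> 0) by apply/funext => x; exact: horner0.
  rewrite h0 in h; exact: h.
apply/eqP => /poweR_eq0_eq0; rewrite -/(sqint eps f) => /(_ (sqint_ge0 _ _)) sq0.
have mg : measurable_fun D (fun x => (normc (f x) ^+ 2 * (2 * weight eps x))%:E).
  by apply/measurable_EFinP; apply: measurable_sqint; split.
have [+ _] := ae_eq_integral_abs mu (measurable_itv _) mg.
have -> : (\int[mu]_(x in D) `|(normc (f x) ^+ 2 * (2 * weight eps x))%:E| = 0)%E.
  rewrite -[RHS]sq0; apply: eq_integral => x; rewrite inE => Dx.
  by rewrite gee0_abs// lee_fin mulr_ge0 ?exprn_even_ge0// mulr_ge0 ?w0.
move=> /(_ erefl) [N [mN muN subN]].
(* [U 2] is [x], because [b 1 = 1], and [|x - F x| <= t 2 * x^2]. So [F] has no zero on []0, del[],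
   an interval of positive measure. *)
pose del : R := (1 + t 2%N)^-1.
have del0 : 0 < del by rewrite invr_gt0 ltr_pwDl.
have del1 : del <= 1 by rewrite invf_le1 ?lerDl// ltr_pwDl.
have : (mu (`]0, del[%classic : set R)%R <= mu N)%E.
  apply: le_measure; rewrite ?inE//.
  move=> x; rewrite /= in_itv /= => /andP[x0 xd].
  have x1 : x < 1 := lt_le_trans xd del1.
  have Dx : D x by rewrite /= in_itv /= x0.
  apply: subN => /(_ Dx) /eqP; apply/negP.
  have wgt : 0 < weight eps x.
    by rewrite weightE mulr_gt0 ?invr_gt0// density_gt0// x1 ltW.
  rewrite eqe normc_sqr /= expr0n addr0 mulf_neq0//; last first.
    by rewrite mulf_neq0 ?pnatr_eq0// gt_eqF.
  rewrite expf_neq0//; apply/negP => /eqP Fx0.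
  have := UF 2%N x Dx; rewrite Fx0 subr0 horner_trunc big_nat_recl// big_nat1.
  rewrite /a mul0r mul0r add0r /b /= divr1 mul1r expr1 ger0_norm ?(ltW x0)// expr2.
  rewrite leNgt mulrA gtr_pMl//.
  move: xd; rewrite /del -[X in _ < X]mul1r ltr_pdivlMr ?ltr_pwDl//.
  by have := t0 2%N; move: x0; nra.
rewrite muN lebesgue_measure_itv /= lte_fin del0 oppr0 adde0 lee_fin leNgt del0.
by [].
Qed.

End sufficient.

(** * Localisation of the eigenvalues and passage to the limit *)

(** Alternation is enough here: it bounds the solution and makes [b_k / k] summable, which is what
    [eigenvalue_of_summable] asks for. *)
Lemma eigenvalue_exists_near_nat (R : realType) (eps d : R) k : 0 < eps <= 4^-1 ->
  0 < d <= 2^-1 -> (0 < k)%N -> small_eps eps d k ->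
  exists2 l, L_eigenvalue eps l%:C%C & `|l - k%:R| <= d.
Proof.
move=> he hd k0 hs; have /andP[e0 _] := he; have /andP[d0 d2] := hd.
have [l hl hal] := rsol_alternating_exists e0 hd k0 hs.
exists l => //.
have ha j : (k < j)%N -> 0 <= rcoef eps l j by exact: near_nat_rcoef_ge0 hl.
have [C _ hC] := alternates_bounded (rsol_recurrence _) hal ha.
have k1 : 0 < k.+1%:R :> R by rewrite ltr0n.
(* For [j > k] and [l <= k + 1/2] one has [2 (j - l) >= j / (k + 1)], hence [rcoef eps l j >= c / j]
   with this constant [c]. *)
have c0 : 0 < eps^-1 / k.+1%:R by rewrite divr_gt0// invr_gt0.
have [|S hS] := alternates_summable (rsol_recurrence _) hal c0.
  move=> j kj; have j0 : 0 < j%:R :> R by rewrite ltr0n; lia.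
  rewrite /rcoef ler_pdivlMr ?exprn_gt0//.
  rewrite (_ : _ * _ ^+ 2 = eps^-1 * (j%:R / k.+1%:R)); last first.
    by field; rewrite nat1r pnatr_eq0 !gt_eqF.
  rewrite (_ : 2 / eps * _ = eps^-1 * (2 * (j%:R - l))); last by ring.
  rewrite ler_wpM2l ?invr_ge0 ?(ltW e0)// ler_pdivrMr//.
  have : k.+1%:R <= j%:R :> R by rewrite ler_nat.
  have : 0 <= k%:R :> R by [].
  by move: hl; rewrite ler_norml -natr1 => /andP[_]; nra.
exact: eigenvalue_of_summable he hC hS.
Qed.

Theorem theorem4p3 (R : realType) (lambda : R -> nat -> R)
    (hlambda : forall eps : R, 0 < eps < 1 ->
       lists_eigenvalues eps (lambda eps))
    (n : nat) (hn : (1 <= n)%N) :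
  lambda eps n @[eps --> (0 : R)^'+] --> (n%:R : R).
Proof.
apply/cvgrPdist_le => e e0.
(* The bound [1/4] keeps the windows of radius [d] around distinct integers disjoint. *)
pose d := Num.min e 4^-1.
have d0 : 0 < d by rewrite lt_min e0 invr_gt0 ltr0n.
have d4 : d <= 4^-1 by rewrite ge_min lexx orbT.
have de : d <= e by rewrite ge_min lexx.
have d02 : 0 < d <= 2^-1 by rewrite d0; lra.
(* [small_eps eps d n] amounts to [eps * K <= 2 * d], which holds for all small [eps]. *)
pose K : R := (2 * n%:R + 1) * n.+2%:R ^+ 2.
have K0 : 0 < K by rewrite mulr_gt0 ?exprn_gt0 ?ltr0n// ltr_wpDl// mulr_ge0.
near=> eps.
have e_gt0 : 0 < eps by near: eps; exact: nbhs_right_gt.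
have e_le4 : eps <= 4^-1 by near: eps; apply: nbhs_right_le.
have hs : small_eps eps d n.
  rewrite /small_eps mulrAC -/K mulrC -ler_pdivlMr//.
  by near: eps; apply: nbhs_right_le; rewrite divr_gt0// mulr_gt0.
have he : 0 < eps <= 4^-1 by rewrite e_gt0.
have [lmono lall] : lists_eigenvalues eps (lambda eps) by apply: hlambda; rewrite e_gt0; lra.
rewrite distrC (le_trans _ de)//.
apply: (@listed_near_nat _ (fun x => L_eigenvalue eps x%:C%C) (lambda eps) d n) => //.
- by rewrite d0.
- move=> x; rewrite lall; split=> -[m m1 hm]; exists m => //; last by rewrite hm.
  by case: hm.
- move=> x hx xn; apply: rsol_cvg0_near_nat hs _ xn => //.
  exact: eigenvalue_rsol_cvg0.
- move=> k /andP[k0 kn]; apply: eigenvalue_exists_near_nat => //.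
  exact: small_le hs.
- move=> x y k /andP[k0 kn] hx hy.
  apply: (rsol_cvg0_unique e_gt0 d02 k0 (small_le e_gt0 kn hs));
    exact: eigenvalue_rsol_cvg0.
- by rewrite hn leqnn.
Unshelve. all: by end_near. Qed.
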